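(* Let $\omega=\{\omega_n\}_{n\ge0}$ be a quasi-integral sequence of positive reals with $\omega_0=1$ and $\lim_{n\to\infty}\omega_n/\omega_{n+1}=1$. Suppose $f\in H^2_\omega$ is such that $W_f/f$ has a singularity on the unit circle and $f(0)\ne0$. Then every point on the unit circle is a limit point of the zeros of the optimal approximants $p_n$ ($n\in\mathbb{N}$) of $1/f$.
   Context: $H^2_\omega$ is the Hilbert space of functions $f(z)=\sum_{n\ge0}a_nz^n$ analytic in the open unit disk $\mathbb{D}$ with $\|f\|_\omega^2=\sum|a_n|^2\omega_n<\infty$. The $n$th optimal approximant $p_n$ to $1/f$ is the unique polynomial of degree at most $n$ minimizing $\|pf-1\|_\omega$ among polynomials $p$ of degree at most $n$. $W_f$ is the orthogonal projection in $H^2_\omega$ of the constant function $1$ onto the closure of $f\cdot\mathcal{P}$, where $\mathcal{P}$ is the space of all polynomials; $W_f/f$ is analytic in $\mathbb{D}$, and it has a singularity on the unit circle if it does not extend analytically to a disk $\{|z|<R\}$ with $R>1$. A finite positive Borel measure $\mu$ on $\overline{\mathbb{D}}$ (with infinite support) is regular if the leading coefficients $\kappa_n>0$ of its orthonormal polynomials in $L^2(\mu)$ satisfy $\lim_{n\to\infty}\kappa_n^{1/n}=1$. The sequence $\omega$ is quasi-integral if there is a regular rotation invariant measure $\mu$ on $\overline{\mathbb{D}}$ such that the norm $\left(\int_{\overline{\mathbb{D}}}|g|^2d\mu\right)^{1/2}$ is equivalent to $\|g\|_\omega$ on $H^2_\omega$ (boundary values are used if $\mu$ charges the unit circle). *)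

(* Defs.v *)
From HB Require Import structures.
From mathcomp Require Import all_boot all_order all_algebra.
From mathcomp Require Import complex.
From mathcomp Require Import all_classical all_reals all_analysis.
Set Implicit Arguments.
Unset Strict Implicit.
Unset Printing Implicit Defensive.
Import Order.TTheory GRing.Theory Num.Theory.
Import numFieldTopology.Exports numFieldNormedType.Exports.

Local Open Scope classical_set_scope.
Local Open Scope ring_scope.

(* [R[i]] itself carries no canonical topology; seen through its
   [numClosedFieldType] structure it inherits the metric topology. *)
Definition cplx (R : realType) : numClosedFieldType := (complex R : numClosedFieldType).

Definition ofreal (R : realType) (x : R) : cplx R := real_complex R x.

(* The modulus as an element of [R] (whereas [`|z|] lives in [cplx R]). *)
Definition cabs (R : realType) (z : cplx R) : R := Normc.normc z.

Definition cRe (R : realType) (z : cplx R) : R := complex.Re z.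
Definition cIm (R : realType) (z : cplx R) : R := complex.Im z.

Definition disk (R : realType) (r : R) : set (cplx R) := [set z | cabs z < r].
Definition closed_disk (R : realType) : set (cplx R) := [set z | cabs z <= 1].
Definition circle (R : realType) : set (cplx R) := [set z | cabs z = 1].

(* Elements of H^2_omega are represented by functions on [cplx R] of which
   only the values on the open unit disk matter. *)
Definition power_series (R : realType) (a : nat -> cplx R)
    (h : cplx R -> cplx R) : Prop :=
  forall z, disk 1 z -> series (fun k => a k * z ^+ k) n @[n --> \oo] --> h z.

(* The coefficients are unique when they exist. *)
Definition coefs (R : realType) (h : cplx R -> cplx R) : nat -> cplx R :=
  xget (fun=> 0) [set a | power_series a h].

(* ||h||_omega^2, possibly +oo *)
Definition h2sqnorm (R : realType) (omega : nat -> R) (h : cplx R -> cplx R)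
    : \bar R :=
  (\sum_(n <oo) (cabs (coefs h n) ^+ 2 * omega n)%:E)%E.

Definition H2 (R : realType) (omega : nat -> R) : set (cplx R -> cplx R) :=
  [set h | (exists a, power_series a h) /\ (h2sqnorm omega h < +oo)%E].

Definition h2dot (R : realType) (omega : nat -> R) (g h : cplx R -> cplx R)
    : cplx R :=
  lim (series (fun k => coefs g k * (coefs h k)^* * ofreal (omega k)) n
       @[n --> \oo]).

Definition pmul (R : realType) (p : {poly cplx R}) (f : cplx R -> cplx R)
    : cplx R -> cplx R :=
  fun z => p.[z] * f z.

Definition optimal_approximant (R : realType) (omega : nat -> R)
    (f : cplx R -> cplx R) (n : nat) (p : {poly cplx R}) : Prop :=
  (size p <= n.+1)%N /\
  forall q : {poly cplx R}, (size q <= n.+1)%N ->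
    (h2sqnorm omega (fun z => (pmul p f z - 1)%R) <=
     h2sqnorm omega (fun z => (pmul q f z - 1)%R))%E.

Definition closure_fP (R : realType) (omega : nat -> R) (f : cplx R -> cplx R)
    : set (cplx R -> cplx R) :=
  [set g | H2 omega g /\
     forall e : R, 0 < e -> exists p : {poly cplx R},
       (h2sqnorm omega (fun z => (pmul p f z - g z)%R) < e%:E)%E].

(* W is the orthogonal projection of 1 onto the closure of f P. *)
Definition is_W (R : realType) (omega : nat -> R) (f W : cplx R -> cplx R)
    : Prop :=
  closure_fP omega f W /\
  forall g, closure_fP omega f g -> h2dot omega (fun z => 1 - W z) g = 0.

Definition analytic_in_disk (R : realType) (r : R) (g : cplx R -> cplx R)
    : Prop :=
  forall z, disk r z -> derivable (g : (cplx R)^o -> (cplx R)^o) z 1.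

(* The clause [f z != 0] is needed because x / 0 = 0; the zeros of f in the
   disk are isolated, and W / f has removable singularities there. *)
Definition quotient_singular_on_circle (R : realType)
    (W f : cplx R -> cplx R) : Prop :=
  ~ exists r : R, exists g : cplx R -> cplx R,
      [/\ 1 < r, analytic_in_disk r g &
          forall z, disk 1 z -> f z != 0 -> g z = W z / f z].

(* The complex plane with its Borel sigma-algebra. *)
Definition borelC (R : realType) := g_sigma_algebraType (@open (cplx R)).

Definition on_closed_disk (R : realType)
    (mu : {finite_measure set (borelC R) -> \bar R}) : Prop :=
  mu (~` @closed_disk R) = 0%E.

Definition rotation_invariant (R : realType)
    (mu : {finite_measure set (borelC R) -> \bar R}) : Prop :=
  forall u : cplx R, circle u -> forall A : set (borelC R), measurable A ->
    mu [set z | A (u * (z : cplx R))] = mu A.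

Definition msupport (R : realType)
    (mu : {finite_measure set (borelC R) -> \bar R}) : set (cplx R) :=
  [set z | forall U : set (cplx R), open U -> U z -> (0 < mu U)%E].

Definition cintegral (R : realType)
    (mu : {finite_measure set (borelC R) -> \bar R})
    (h : cplx R -> cplx R) : cplx R :=
  Complex (\int[mu]_(z in @closed_disk R) cRe (h z))
          (\int[mu]_(z in @closed_disk R) cIm (h z)).

(* [0 < lead_coef _] in [cplx R] says real and positive. *)
Definition orthonormal_polys (R : realType)
    (mu : {finite_measure set (borelC R) -> \bar R})
    (phi : nat -> {poly cplx R}) : Prop :=
  (forall n, size (phi n) = n.+1 /\ 0 < lead_coef (phi n)) /\
  (forall m n,
     cintegral mu (fun z => (phi m).[z] * ((phi n).[z])^*) = (m == n)%:R).

Definition regular_measure (R : realType)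
    (mu : {finite_measure set (borelC R) -> \bar R}) : Prop :=
  [/\ on_closed_disk mu, infinite_set (msupport mu) &
      exists2 phi, orthonormal_polys mu phi &
        powR (cabs (lead_coef (phi n))) (n%:R^-1) @[n --> \oo] --> (1 : R)].

(* g on the open disk, radial limits of g on the unit circle.
   When mu charges the circle, the upper bound in [quasi_integral] applied to
   monomials gives inf omega > 0, so that H^2_omega is contained in the Hardy
   space and the radial limits exist mu-almost everywhere on the circle. *)
Definition with_boundary_values (R : realType) (g : cplx R -> cplx R)
    : cplx R -> cplx R :=
  fun z => if cabs z < 1 then g z
           else lim (g (ofreal r * z) @[r --> (1 : R)^'-]).

(* The equivalence of norms is written with squared norms. *)
Definition quasi_integral (R : realType) (omega : nat -> R) : Prop :=
  exists mu : {finite_measure set (borelC R) -> \bar R},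
    [/\ regular_measure mu, rotation_invariant mu &
        exists c K : R, [/\ 0 < c, 0 < K &
          forall g, H2 omega g ->
            let I := (\int[mu]_(z in @closed_disk R)
                        (cabs (with_boundary_values g z) ^+ 2)%:E)%E in
            (c%:E * h2sqnorm omega g <= I)%E /\
            (I <= K%:E * h2sqnorm omega g)%E]].

(* Main.v *)
From HB Require Import structures.
Require Import Defs.
From mathcomp Require Import all_boot all_order all_algebra.
From mathcomp Require Import cyclic separable cyclotomic.
From mathcomp Require Import complex.
From mathcomp Require Import all_classical all_reals all_analysis.
From mathcomp Require Import zify ring lra.

(** Write [l_n] for the coefficient of [z ^ n] in [p_n].  Minimality makes
    [(p_n - p_(n-1)) f] orthogonal to [f q] for every [q] of degree less than
    [n], so its norm is at most [|l_n|] times the norm of [z ^ n f], which is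
    subexponential.  Exponential decay of [l_n] therefore makes [p_n] converge
    on a disk of radius larger than 1, to an extension of [W / f].

    Suppose that the [p_n] have no zeros near a point [zeta] of the circle.
    Expand [p_n] at a point [b] of the unit disk close to [zeta], with
    [W b != 0].  As [p_n] is bounded near [b] and bounded below at [b], the
    power sums of the reciprocals of its zeros (relative to [b]) of any fixed
    order are bounded; those of order [i] are also at most [n s ^ -i], where [s]
    is the distance to the nearest zero.  By Newton's identities [p_n] then
    grows subexponentially on a neighbourhood of [zeta].  It is also bounded on
    compact subsets of the unit disk, with all its coefficients of
    subexponential size, so the maximum principle for a product of rotates of
    [w ^ n p_n(1 / w)] makes [l_n] decay exponentially. *)

Set Implicit Arguments.
Unset Strict Implicit.
Unset Printing Implicit Defensive.
Import Order.TTheory GRing.Theory Num.Theory.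
Import numFieldTopology.Exports numFieldNormedType.Exports.
Local Open Scope classical_set_scope.
Local Open Scope ring_scope.

(** * The modulus and Cauchy estimates *)

(** The point [b] has to lie inside the disk: only there are the [p_n] bounded, and there [p_n f]
    tends to [W], so that [W b != 0] keeps [p_n] away from 0 at [b]. Cauchy's inequalities then
    bound each Taylor coefficient of [p_n(b + w) / p_n(b)], hence each power sum, independently of
    [n]. The zero-free disk around [b] reaches beyond the unit circle; for [w] well inside it, the
    contribution of the power sums of high order is a small fraction of [n], and this makes the rate
    of growth as small as desired.

    The rotates are needed because, on a circle of radius less than 1, [w ^ n p_n(1 / w)] is known
    to be exponentially small only where [1 / w] is near [zeta]; elsewhere it is bounded by a
    multiple of [r ^ -n], with [r] as close to 1 as desired. A fixed number [k] of rotates brings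
    every point of the circle to the good arc of one factor, and [r] is chosen after [k], so that
    the gain of that factor outweighs the losses of the others.

    No contour integral occurs: Cauchy's inequalities are proved for polynomials by averaging over
    roots of unity, and reach power series through their partial sums. *)

Section Modulus.
Context {R : realType}.
Implicit Types (x y z : cplx R) (r : R).

Lemma normE z : `|z| = ofreal (cabs z).
Proof. by case: z. Qed.

Lemma ofreal_is_zmod : zmod_morphism (@ofreal R).
Proof. exact: (rmorphB (real_complex R)). Qed.

Lemma ofreal_is_monoid : monoid_morphism (@ofreal R).
Proof. by split; [exact: (rmorph1 (real_complex R)) | exact: (rmorphM (real_complex R))]. Qed.

HB.instance Definition _ :=
  GRing.isZmodMorphism.Build R (cplx R) (@ofreal R) ofreal_is_zmod.
HB.instance Definition _ :=
  GRing.isMonoidMorphism.Build R (cplx R) (@ofreal R) ofreal_is_monoid.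

Lemma ofreal_le r1 r2 : (ofreal r1 <= ofreal r2) = (r1 <= r2).
Proof. exact: lecR. Qed.

Lemma ofreal_lt r1 r2 : (ofreal r1 < ofreal r2) = (r1 < r2).
Proof. exact: ltcR. Qed.

Lemma ofreal_inj : injective (@ofreal R).
Proof. exact: (fmorph_inj (real_complex R)). Qed.

Lemma cabs_ge0 z : 0 <= cabs z.
Proof. by rewrite -ofreal_le rmorph0 -normE. Qed.

Lemma cabs0 : cabs (0 : cplx R) = 0.
Proof. by apply: ofreal_inj; rewrite -normE normr0 rmorph0. Qed.

Lemma cabs1 : cabs (1 : cplx R) = 1.
Proof. by apply: ofreal_inj; rewrite -normE normr1 rmorph1. Qed.

Lemma cabsM x y : cabs (x * y) = cabs x * cabs y.
Proof. by apply: ofreal_inj; rewrite rmorphM -!normE normrM. Qed.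

Lemma cabsN x : cabs (- x) = cabs x.
Proof. by apply: ofreal_inj; rewrite -!normE normrN. Qed.

Lemma cabsB x y : cabs (x - y) = cabs (y - x).
Proof. by rewrite -cabsN opprB. Qed.

Lemma cabsV x : cabs (x^-1) = (cabs x)^-1.
Proof. by apply: ofreal_inj; rewrite fmorphV -!normE normfV. Qed.

Lemma cabsX x n : cabs (x ^+ n) = cabs x ^+ n.
Proof. by apply: ofreal_inj; rewrite rmorphXn -!normE normrX. Qed.

Lemma cabsD x y : cabs (x + y) <= cabs x + cabs y.
Proof. by rewrite -ofreal_le rmorphD -!normE ler_normD. Qed.

Lemma cabs_eq0 x : (cabs x == 0) = (x == 0).
Proof. by rewrite -(inj_eq ofreal_inj) -normE rmorph0 normr_eq0. Qed.

Lemma cabs_gt0 x : (0 < cabs x) = (x != 0).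
Proof. by rewrite lt_def cabs_ge0 andbT cabs_eq0. Qed.

Lemma cabs_ofreal r : cabs (ofreal r) = `|r|.
Proof. by rewrite /cabs /ofreal /= expr0n /= addr0 sqrtr_sqr. Qed.

Lemma cabs_subr x y z : cabs (x - z) <= cabs (x - y) + cabs (y - z).
Proof. by rewrite -[x - z](subrKA y) cabsD. Qed.

Lemma cabs_rev x y : cabs x - cabs y <= cabs (x - y).
Proof. by rewrite lerBlDr -{1}(subrK y x) cabsD. Qed.

Lemma cabs_sum (I : Type) (s : seq I) (P : pred I) (F : I -> cplx R) :
  cabs (\sum_(i <- s | P i) F i) <= \sum_(i <- s | P i) cabs (F i).
Proof.
elim/big_rec2 : _ => [|i y1 y2 _ h]; first by rewrite cabs0.
by rewrite (le_trans (cabsD _ _))// lerD2l.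
Qed.

Lemma cabs_prod (I : Type) (s : seq I) (P : pred I) (F : I -> cplx R) :
  cabs (\prod_(i <- s | P i) F i) = \prod_(i <- s | P i) cabs (F i).
Proof. by rewrite (big_morph (@cabs R) cabsM cabs1). Qed.

Lemma cabs_nat n : cabs (n%:R : cplx R) = n%:R.
Proof. by rewrite -(rmorph_nat (@ofreal R)) cabs_ofreal ger0_norm. Qed.

Lemma cabsJ z : cabs z^* = cabs z.
Proof. by apply: ofreal_inj; rewrite -!normE norm_conjC. Qed.

Lemma mulrJ z : z * z^* = ofreal (cabs z ^+ 2).
Proof. by rewrite -normCK normE -rmorphXn. Qed.

End Modulus.

Section CauchyEstimate.
Context {R : realType}.
Notation C := (cplx R).

Lemma prim_root_exists n : (0 < n)%N -> exists z : C, n.-primitive_root z.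
Proof.
move=> n_gt0; set p : {poly C} := 'X^n - 1.
have [r def_p] := closed_field_poly_normal p.
move: def_p; rewrite (monicP _) ?monicXnsubC // scale1r => def_p.
have rn1 : all n.-unity_root r by apply/allP=> z; rewrite -root_prod_XsubC -def_p.
have size_r : (n < (size r).+1)%N by rewrite -(size_prod_XsubC r id) -def_p size_XnsubC.
have [|z] := hasP (has_prim_root n_gt0 rn1 _ size_r); last by exists z.
by rewrite -separable_prod_XsubC -def_p separable_Xn_sub_1 // pnatr_eq0 -lt0n.
Qed.

Lemma cabs_unity n (z : C) : n.-primitive_root z -> cabs z = 1.
Proof.
move=> zn; have n_gt0 := prim_order_gt0 zn.
have := prim_expr_order zn => /(congr1 (@cabs R)); rewrite cabsX cabs1 => /eqP.
by rewrite pexprn_eq1 ?cabs_ge0// => /orP[|/eqP//]; rewrite eqn0Ngt n_gt0.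
Qed.

(** Orthogonality of characters; this finite average takes the place of a contour integral. *)
Lemma sum_unity_ratio n (xi : C) (i j : 'I_n) : n.-primitive_root xi ->
  \sum_(k < n) (xi ^+ i / xi ^+ j) ^+ k = if i == j then n%:R else 0.
Proof.
move=> prim; have xi0 : xi != 0 by rewrite -cabs_gt0 (cabs_unity prim).
case: eqP => [->|/eqP neq].
  rewrite divff ?expf_neq0// (eq_bigr (fun=> 1)) ?sumr_const ?card_ord//.
  by move=> k _; rewrite expr1n.
set u := _ / _.
have un : u ^+ n = 1.
  by rewrite exprMn exprVn -!exprM ![(_ * n)%N]mulnC !exprM (prim_expr_order prim) !expr1n divr1.
have u1 : u - 1 != 0.
  rewrite subr_eq0; apply: contra neq => /eqP /(congr1 ( *%R^~ (xi ^+ j))).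
  rewrite mul1r divfK ?expf_neq0// => /eqP.
  by rewrite (eq_prim_root_expr prim) !modn_small.
by apply: (mulfI u1); rewrite -subrX1 un subrr mulr0.
Qed.

Lemma cauchy_estimate (P : {poly C}) (rho M : R) j : 0 <= rho ->
  (forall z, cabs z = rho -> cabs P.[z] <= M) -> cabs P`_j * rho ^+ j <= M.
Proof.
(* [n] exceeds [j] and every exponent in [P], so sampling at the [n]-th roots of unity isolates the
   coefficient of index [j] without aliasing. *)
move=> rho0 PM; set n := (size P + j).+1.
have n_gt0 : (0 < n)%N by [].
have jn : (j < n)%N by rewrite /n; lia.
have [xi prim] := prim_root_exists n_gt0; have cxi := cabs_unity prim.
have key : n%:R * (P`_j * ofreal rho ^+ j) =
    \sum_(k < n) P.[ofreal rho * xi ^+ k] / xi ^+ (k * j).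
  rewrite (eq_bigr (fun k : 'I_n => \sum_(i < n) P`_i * ofreal rho ^+ i *
      (xi ^+ i / xi ^+ j) ^+ k)); last first.
    move=> k _; rewrite (@horner_coef_wide _ n); last by rewrite /n; lia.
    rewrite mulr_suml; apply: eq_bigr => i _.
    by rewrite !exprMn exprVn -!exprM ![(_ * k)%N]mulnC !mulrA.
  rewrite exchange_big /= (bigD1 (Ordinal jn)) //= [X in _ + X]big1 ?addr0.
    by rewrite -mulr_sumr (sum_unity_ratio (Ordinal jn) (Ordinal jn) prim) eqxx mulrC.
  move=> i neq; rewrite -mulr_sumr (sum_unity_ratio i (Ordinal jn) prim).
  by rewrite (negPf neq) mulr0.
have nR : 0 < n%:R :> R by rewrite ltr0n.
rewrite -(ler_pM2l nR) -{1}(ger0_norm rho0) -cabs_ofreal -cabsX -cabsM.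
rewrite -[X in X * _]cabs_nat -cabsM key (le_trans (cabs_sum _ _ _))//.
rewrite [leRHS]mulrC mulr_natr -[in leRHS](card_ord n) -sumr_const ler_sum// => k _.
by rewrite cabsM cabsV cabsX cxi expr1n invr1 mulr1 PM// cabsM cabsX cxi expr1n mulr1 cabs_ofreal ger0_norm.
Qed.

Lemma mean_value_bound (P : {poly C}) (rho M : R) : 0 <= rho ->
  (forall z, cabs z = rho -> cabs P.[z] <= M) -> cabs P.[0] <= M.
Proof. by move=> r0 /(cauchy_estimate 0 r0); rewrite expr0 mulr1 horner_coef0. Qed.

End CauchyEstimate.

(** * Zeros of power series *)

Section Zeros.
Context {R : realType}.
Notation C := (cplx R).

(* Multiplying [P / prod (X - z)] by the numerators of the Blaschke factors
   multiplies its modulus by the constant [rho ^+ size zs] on the circle. *)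
Lemma jensen_bound (P : {poly C}) (zs : seq C) (rho M : R) : 0 < rho ->
  uniq zs -> all (root P) zs ->
  (forall z, cabs z = rho -> cabs P.[z] <= M) ->
  cabs P.[0] * rho ^+ size zs <= M * \prod_(z <- zs) cabs z.
Proof.
move=> rho0 uzs rzs PM.
have /dvdpP[Q defP] : \prod_(z <- zs) ('X - z%:P) %| P.
  by apply: uniq_roots_dvdp => //; rewrite uniq_rootsE.
pose B := Q * \prod_(z <- zs) ((ofreal rho ^+ 2)%:P - z^* *: 'X).
have BE w : B.[w] = Q.[w] * \prod_(z <- zs) (ofreal rho ^+ 2 - z^* * w).
  by rewrite hornerM horner_prod; congr (_ * _); apply: eq_bigr => z _; rewrite !hornerE.
have PE w : P.[w] = Q.[w] * \prod_(z <- zs) (w - z).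
  by rewrite defP hornerM horner_prod; congr (_ * _); apply: eq_bigr => z _; rewrite !hornerE.
have bound : cabs B.[0] <= rho ^+ size zs * M.
  apply: (@mean_value_bound _ B rho) => [|w hw]; first exact: ltW.
  rewrite BE cabsM cabs_prod (eq_bigr (fun z => rho * cabs (w - z))); last first.
    (* On the circle [rho ^ 2 = w w^*], so each new factor is [w] times the conjugate of [w - z]. *)
    move=> z _; rewrite (_ : ofreal rho ^+ 2 = w * w^*); last by rewrite mulrJ hw rmorphXn.
    rewrite -hw.
    by rewrite [_^* * w]mulrC -mulrBr cabsM -rmorphB cabsJ.
  rewrite big_split /= big_const_seq count_predT -Monoid.iteropE /=.
  by rewrite mulrCA ler_pM2l ?exprn_gt0// -cabs_prod -cabsM -PE PM.
have pos : 0 < rho ^+ size zs by rewrite exprn_gt0.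
rewrite -(ler_pM2r pos).
have -> : cabs P.[0] * rho ^+ size zs * rho ^+ size zs =
   cabs B.[0] * \prod_(z <- zs) cabs z.
  rewrite PE BE !cabsM !cabs_prod -!mulrA; congr (_ * _).
  rewrite [X in _ = X * _](eq_bigr (fun=> rho * rho)); last first.
    by move=> z _; rewrite mulr0 subr0 cabsX cabs_ofreal gtr0_norm.
  rewrite big_split /= big_const_seq count_predT -Monoid.iteropE /=.
  rewrite (eq_bigr (fun z => cabs z)); first by rewrite mulrC.
  by move=> z _; rewrite sub0r cabsN.
apply: le_trans (ler_wpM2r _ bound) _; first by rewrite prodr_ge0// => z _; exact: cabs_ge0.
by rewrite -mulrA mulrC.
Qed.

Lemma poly_bounded (p : {poly C}) (rho : R) :
  exists2 K, 0 < K & forall z, cabs z <= rho -> cabs p.[z] <= K.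
Proof.
exists (1 + \sum_(i < size p) cabs p`_i * `|rho| ^+ i).
  by rewrite ltr_pwDl// sumr_ge0// => i _; rewrite mulr_ge0 ?cabs_ge0 ?exprn_ge0.
move=> z zr; rewrite horner_coef (le_trans (cabs_sum _ _ _))//.
rewrite ler_wpDl// ler_sum// => i _; rewrite cabsM cabsX ler_wpM2l ?cabs_ge0//.
by rewrite lerXn2r ?nnegrE ?cabs_ge0// (le_trans zr)// ler_norm.
Qed.

Definition psum (a : nat -> C) n : {poly C} := \poly_(k < n) a k.

Lemma psumE a n z : (psum a n).[z] = \sum_(k < n) a k * z ^+ k.
Proof. by rewrite /psum horner_poly. Qed.

Lemma cvg_cabs (u : nat -> C) l : u n @[n --> \oo] --> l ->
  forall e : R, 0 < e -> exists N, forall n, (N <= n)%N -> cabs (l - u n) <= e.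
Proof.
move=> /cvgrPdist_le ul e e0.
have [|N _ hN] := ul (ofreal e); first by rewrite -(rmorph0 (@ofreal R)) ofreal_lt.
by exists N => n Nn; have := hN n Nn; rewrite normE ofreal_le.
Qed.

Lemma power_series_cvg a (h : C -> C) z : power_series a h -> cabs z < 1 ->
  forall e : R, 0 < e ->
  exists N, forall n, (N <= n)%N -> cabs (h z - (psum a n).[z]) <= e.
Proof.
move=> ah z1 e e0; have [N hN] := cvg_cabs (ah z z1) e0.
exists N => n /hN; rewrite psumE /series /=.
by rewrite big_mkord.
Qed.

Lemma power_series_coef_bound a (h : C -> C) (r : R) :
  power_series a h -> 0 <= r -> r < 1 ->
  exists2 M, 0 < M & forall k, cabs (a k) * r ^+ k <= M.
Proof.
move=> ah r0 r1; set z := ofreal r.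
have cz : cabs z = r by rewrite cabs_ofreal ger0_norm.
have [|N hN] := @power_series_cvg a h z ah _ 1 ltr01; first by rewrite cz.
have all_ge0 k : 0 <= cabs (a k) * r ^+ k by rewrite mulr_ge0 ?cabs_ge0 ?exprn_ge0.
exists (2 + \sum_(k < N) cabs (a k) * r ^+ k).
  by rewrite ltr_pwDl// sumr_ge0.
move=> k; have [kN|Nk] := ltnP k N.
  rewrite (bigD1 (Ordinal kN)) //= addrCA lerDl addr_ge0// sumr_ge0//.
rewrite ler_wpDr ?sumr_ge0//.
have -> : cabs (a k) * r ^+ k = cabs ((psum a k.+1).[z] - (psum a k).[z]).
  by rewrite !psumE big_ord_recr /= addrAC subrr add0r cabsM cabsX cz.
(* A term is the difference of two partial sums, each within 1 of [h z]: hence the constant 2. *)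
apply: le_trans (cabs_subr _ (h z) _) _.
by rewrite -[2]/(1 + 1) lerD// ?(cabsB _ (h z)) hN// leqW.
Qed.

Lemma power_series_tail a (h : C -> C) (r s M : R) z n :
  power_series a h -> 0 < r -> r < 1 -> 0 <= s -> s < r ->
  (forall k, cabs (a k) * r ^+ k <= M) -> cabs z <= s ->
  cabs (h z - (psum a n).[z]) <= M * (s / r) ^+ n / (1 - s / r).
Proof.
move=> ah r0 r1 s0 sr aM zs; set q := s / r.
have q0 : 0 <= q by rewrite divr_ge0// ltW.
have q1 : q < 1 by rewrite ltr_pdivrMr// mul1r.
have M0 : 0 <= M by rewrite (le_trans _ (aM 0%N))// mulr_ge0 ?cabs_ge0 ?exprn_ge0 ?ltW.
apply/ler_addgt0Pr => e e0.
have [|N hN] := @power_series_cvg a h z ah _ e e0.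
  by rewrite (le_lt_trans zs)// (lt_trans sr).
have nN : (n <= maxn n N)%N by rewrite leq_maxl.
rewrite [leRHS]addrC; apply: le_trans (cabs_subr _ (psum a (maxn n N)).[z] _) _.
rewrite lerD ?hN ?leq_maxr//.
have -> : (psum a (maxn n N)).[z] - (psum a n).[z] =
    \sum_(k < maxn n N - n) a (n + k)%N * z ^+ (n + k).
  rewrite !psumE -(big_mkord xpredT (fun k => a k * z ^+ k)) /=.
  rewrite (big_cat_nat (n := n))//= big_mkord addrAC subrr add0r.
  rewrite -{1}[n]add0n big_addn big_mkord.
  by apply: eq_bigr => k _; rewrite addnC.
apply: le_trans (cabs_sum _ _ _) _.
apply: (@le_trans _ _ (\sum_(k < maxn n N - n) M * q ^+ n * q ^+ k)).
  apply: ler_sum => k _; rewrite cabsM cabsX -mulrA -exprD.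
  apply: (@le_trans _ _ (cabs (a (n + k)%N) * s ^+ (n + k))).
    by rewrite ler_wpM2l ?cabs_ge0// lerXn2r ?nnegrE ?cabs_ge0.
  rewrite -[s](divfK (lt0r_neq0 r0)) -/q exprMn mulrA mulrAC ler_wpM2r ?exprn_ge0//.
rewrite -mulr_sumr ler_wpM2l ?mulr_ge0 ?exprn_ge0//.
have q1' : 0 < 1 - q by rewrite subr_gt0.
rewrite -[leRHS]mul1r ler_pdivlMr// mulrC -opprB mulNr -subrX1 opprB lerBlDr lerDl exprn_ge0//.
Qed.

Lemma geometric_small (q e : R) : 0 <= q -> q < 1 -> 0 < e ->
  exists N, forall n, (N <= n)%N -> q ^+ n <= e.
Proof.
move=> q0 q1 e0.
have /cvgrPdist_le/(_ e e0)[N _ hN] : q ^+ n @[n --> \oo] --> (0 : R).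
  by apply: cvg_expr; rewrite ger0_norm.
exists N => n Nn; have := hN n Nn.
by rewrite sub0r normrN ger0_norm// exprn_ge0.
Qed.

Lemma power_series_uniform a (h : C -> C) (s e : R) :
  power_series a h -> s < 1 -> 0 < e ->
  exists N, forall n z, (N <= n)%N -> cabs z <= s ->
    cabs (h z - (psum a n).[z]) <= e.
Proof.
move=> ah s1 e0.
have [s0|s0] := ltP s 0.
  by exists 0%N => n z _ zs; have := cabs_ge0 z; rewrite leNgt (le_lt_trans zs).
pose r := (1 + s) / 2.
have r0 : 0 < r by rewrite /r; lra.
have r1 : r < 1 by rewrite /r; lra.
have sr : s < r by rewrite /r; lra.
have [M M0 aM] := power_series_coef_bound ah (ltW r0) r1.
have q0 : 0 <= s / r by rewrite divr_ge0// ltW.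
have q1 : s / r < 1 by rewrite ltr_pdivrMr// mul1r.
have q1' : 0 < 1 - s / r by rewrite subr_gt0.
have [|N hN] := @geometric_small (s / r) (e * (1 - s / r) / M) q0 q1.
  by rewrite divr_gt0// mulr_gt0.
exists N => n z Nn zs.
apply: le_trans (power_series_tail n ah r0 r1 s0 sr aM zs) _.
rewrite ler_pdivrMr// mulrC -ler_pdivlMr//; exact: hN.
Qed.

Lemma power_series_bounded a (h : C -> C) (s : R) :
  power_series a h -> s < 1 ->
  exists2 K, 0 < K & forall z, cabs z <= s -> cabs (h z) <= K.
Proof.
move=> ah s1; have [N hN] := power_series_uniform ah s1 ltr01.
have [K K0 hK] := poly_bounded (psum a N) s.
exists (1 + K); first by rewrite addr_gt0.
move=> z zs; rewrite -[h z](subrK (psum a N).[z]).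
by rewrite (le_trans (cabsD _ _))// lerD ?hN ?hK.
Qed.

(** Jensen's bound wants exact zeros, while partial sums of [h] only nearly vanish at [zs]. The
    zeros are imposed one at a time, by subtracting a small multiple of a polynomial that vanishes
    at those already treated. *)
Lemma power_series_approx_zeros a (h : C -> C) (rho : R) (zs : seq C) :
  power_series a h -> rho < 1 -> uniq zs ->
  (forall z, z \in zs -> cabs z <= rho /\ h z = 0) ->
  forall e, 0 < e -> exists2 P : {poly C}, all (root P) zs &
    forall z, cabs z <= rho -> cabs (P.[z] - h z) <= e.
Proof.
move=> ah rho1; elim: zs => [|z0 zs IH] /=.
  move=> _ _ e e0; have [N hN] := power_series_uniform ah rho1 e0.
  by exists (psum a N) => // z zr; rewrite cabsB hN.
move=> /andP[z0s uzs] hz e e0.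
pose D := \prod_(z <- zs) ('X - z%:P).
have [K K0 hK] := poly_bounded D rho.
have D0 : 0 < cabs D.[z0] by rewrite cabs_gt0 -/(root D z0) root_prod_XsubC.
(* As [h z0 = 0], [P] is at most [e'] at [z0]; the error [e'] of [P] and the size [e' K / |D(z0)|]
   of the correction add up to [e]. *)
pose e' := e / (1 + K / cabs D.[z0]).
have KD : 0 < 1 + K / cabs D.[z0] by rewrite addr_gt0// divr_gt0.
have e'0 : 0 < e' by rewrite divr_gt0.
have hzs z : z \in zs -> cabs z <= rho /\ h z = 0.
  by move=> zzs; apply: hz; rewrite inE zzs orbT.
have [P rP hP] := IH uzs hzs e' e'0.
have [z0r hz0] := hz _ (mem_head _ _).
exists (P - (P.[z0] / D.[z0]) *: D).
  apply/andP; split.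
    by rewrite /root !hornerE divfK ?subrr// -cabs_gt0.
  apply/allP => z zzs; rewrite /root !hornerE.
  have /rootP -> := allP rP _ zzs.
  have /rootP -> : root D z by rewrite root_prod_XsubC.
  by rewrite mulr0 subrr.
move=> z zr; rewrite !hornerE addrAC.
apply: le_trans (cabsD _ _) _; rewrite cabsN !cabsM cabsV.
have -> : e = e' + (e' / cabs D.[z0]) * K.
  by rewrite -mulrA [_^-1 * K]mulrC -{1}[e']mulr1 -mulrDr divfK ?lt0r_neq0.
rewrite lerD ?hP// ler_pM ?cabs_ge0 ?hK ?mulr_ge0 ?invr_ge0 ?cabs_ge0//.
by rewrite ler_wpM2r ?invr_ge0 ?cabs_ge0// -[P.[z0]]subr0 -hz0 hP.
Qed.

(** With [m] zeros, Jensen's bound reads [|h 0| rho ^ m <= M s ^ m]; as [s < rho], this limits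
    [m]. *)
Lemma finitely_many_zeros a (h : C -> C) (s : R) :
  power_series a h -> h 0 != 0 -> s < 1 ->
  exists N, forall zs : seq C, uniq zs ->
    (forall z, z \in zs -> cabs z <= s /\ h z = 0) -> (size zs <= N)%N.
Proof.
move=> ah h0 s1.
have [s0|s0] := ltP s 0.
  exists 0%N => -[//|z zs] _ /(_ z (mem_head _ _))[zs' _].
  by have := cabs_ge0 z; rewrite leNgt (le_lt_trans zs').
pose rho := (1 + s) / 2.
have rho0 : 0 < rho by rewrite /rho; lra.
have rho1 : rho < 1 by rewrite /rho; lra.
have srho : s < rho by rewrite /rho; lra.
have [M M0 hM] := power_series_bounded ah rho1.
have q0 : 0 <= s / rho by rewrite divr_ge0// ltW.
have q1 : s / rho < 1 by rewrite ltr_pdivrMr// mul1r.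
rewrite -cabs_gt0 in h0.
(* The factor 1/2 turns more than [N] zeros into the contradiction [|h 0| <= |h 0| / 2]. *)
have [|N hN] := @geometric_small (s / rho) (cabs (h 0) / M / 2) q0 q1.
  by rewrite !divr_gt0.
exists N => zs uzs hzs; rewrite leqNgt; apply/negP => Nzs.
have bound : cabs (h 0) * rho ^+ size zs <= M * s ^+ size zs.
  apply/ler_addgt0Pr => e e0.
  (* Replacing [h] by [P] costs [e'] on either side of Jensen's bound, in total
     [e' (rho ^ m + s ^ m) = e]. *)
  pose e' := e / (rho ^+ size zs + s ^+ size zs).
  have D0 : 0 < rho ^+ size zs + s ^+ size zs by rewrite ltr_pwDl ?exprn_gt0 ?exprn_ge0.
  have e'0 : 0 < e' by rewrite divr_gt0.
  have [|P rP hP] := power_series_approx_zeros ah rho1 uzs _ e'0.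
    by move=> z /hzs[zs' ->]; split => //; rewrite (le_trans zs')// ltW.
  have PM z : cabs z = rho -> cabs P.[z] <= M + e'.
    move=> zr; rewrite -[P.[z]](subrK (h z)) (le_trans (cabsD _ _))//.
    by rewrite addrC lerD ?hM ?hP ?zr.
  have := jensen_bound rho0 uzs rP PM.
  have P0 : cabs (h 0) - e' <= cabs P.[0].
    rewrite lerBlDr addrC -[h 0](subrK P.[0]) (le_trans (cabsD _ _))//.
    by rewrite lerD2r cabsB hP// cabs0 ltW.
  have prods : \prod_(z <- zs) cabs z <= s ^+ size zs.
    rewrite -(count_predT zs) -[s ^+ _]mulr1 -iter_mulr -big_const_seq.
    rewrite big_seq [leRHS]big_seq ler_prod// => z /hzs[zs' _].
    by rewrite cabs_ge0.
  move=> /le_trans /(_ (ler_wpM2l (ltW (addr_gt0 M0 e'0)) prods)) => H.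
  have : (cabs (h 0) - e') * rho ^+ size zs <= (M + e') * s ^+ size zs.
    by rewrite (le_trans _ H)// ler_wpM2r// exprn_ge0// ltW.
  rewrite mulrBl mulrDl lerBlDr -addrA -mulrDr [s ^+ _ + _]addrC.
  by rewrite /e' divfK ?lt0r_neq0.
have := hN _ (ltnW Nzs); rewrite expr_div_n leNgt => /negP; apply.
rewrite ltr_pdivlMr ?exprn_gt0//.
rewrite -(ltr_pM2l M0) (lt_le_trans _ bound)// -mulrA.
rewrite (_ : M * _ = cabs (h 0) * rho ^+ size zs / 2); last first.
  by field; rewrite lt0r_neq0.
have : 0 < cabs (h 0) * rho ^+ size zs by rewrite mulr_gt0 ?exprn_gt0.
by lra.
Qed.

(** Pigeonhole: among [N + 1] distinct radii between [r0] and [r1], zeros on all the circles would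
    be more than the [N] zeros that are possible. *)
Lemma zero_free_circle a (h : C -> C) (r0 r1 : R) :
  power_series a h -> h 0 != 0 -> r0 < r1 -> r1 < 1 ->
  exists2 r, r0 < r < r1 & forall z, cabs z = r -> h z != 0.
Proof.
move=> ah h0 r01 r11; apply: contrapT => none.
have zero r : r0 < r < r1 -> exists z, cabs z = r /\ h z = 0.
  move=> hr; apply: contrapT => nz; apply: none; exists r => // z zr.
  by apply/negP => /eqP hz; apply: nz; exists z.
have [N hN] := finitely_many_zeros ah h0 r11.
pose rad k : R := r0 + (r1 - r0) * (k.+1%:R / N.+2%:R).
have d0 : 0 < r1 - r0 by rewrite subr_gt0.
have radP k : (k <= N)%N -> r0 < rad k < r1.
  move=> kN; rewrite /rad ltrDl mulr_gt0 ?divr_gt0 ?ltr0n//=.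
  by rewrite -ltrBrDl gtr_pMr// ltr_pdivrMr ?ltr0n// mul1r ltr_nat ltnS.
have /choice[Z hZ] k : exists z, (k <= N)%N -> cabs z = rad k /\ h z = 0.
  by have [kN|_] := leqP k N; [have [z] := zero _ (radP k kN); exists z | exists 0].
suff : (size [seq Z k | k <- iota 0 N.+1] <= N)%N by rewrite size_map size_iota ltnn.
apply: hN => [|z /mapP[k]]; last first.
  rewrite mem_iota => /andP[_ kN] ->; have [-> ->] := hZ k kN.
  by have /andP[_ /ltW] := radP k kN.
rewrite map_inj_in_uniq ?iota_uniq// => i j; rewrite !mem_iota => /andP[_ iN] /andP[_ jN].
move=> /(congr1 (@cabs R)); rewrite (hZ i iN).1 (hZ j jN).1 /rad => /addrI.
move=> /(mulfI (lt0r_neq0 d0)) /mulIf; rewrite invr_eq0 pnatr_eq0 => /(_ isT).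
by move=> /eqP; rewrite eqr_nat => /eqP[].
Qed.

End Zeros.

(** * Minimum modulus and finite nets on circles *)

Section Circles.
Context {R : realType}.
Notation C := (cplx R).

Lemma cabs_le_Re_Im (z : C) : cabs z <= `|cRe z| + `|cIm z|.
Proof.
case: z => x y; rewrite /cabs /cRe /cIm /= -[leRHS]ger0_norm ?addr_ge0// -sqrtr_sqr.
rewrite ler_wsqrtr// sqrrD !real_normK ?num_real// addrAC lerDl mulrn_wge0// mulr_ge0//.
Qed.

Lemma cRe_le (z : C) : `|cRe z| <= cabs z.
Proof.
case: z => x y; rewrite /cabs /cRe /= -sqrtr_sqr ler_wsqrtr// lerDl sqr_ge0//.
Qed.

Lemma cIm_le (z : C) : `|cIm z| <= cabs z.
Proof.
case: z => x y; rewrite /cabs /cIm /= -sqrtr_sqr ler_wsqrtr// lerDr sqr_ge0//.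
Qed.

Lemma cReB (z w : C) : cRe (z - w) = cRe z - cRe w.
Proof. by case: z => ? ?; case: w => ? ?. Qed.

Lemma cImB (z w : C) : cIm (z - w) = cIm z - cIm w.
Proof. by case: z => ? ?; case: w => ? ?. Qed.

Lemma cabs_sqr (z : C) : cabs z ^+ 2 = cRe z ^+ 2 + cIm z ^+ 2.
Proof. by case: z => x y; rewrite /cabs /cRe /cIm /= sqr_sqrtr// addr_ge0 ?sqr_ge0. Qed.

Definition expi (t : R) : C := Complex (cos t) (sin t).

Lemma cabs_expi t : cabs (expi t) = 1.
Proof. by rewrite /cabs /expi /= cos2Dsin2 sqrtr1. Qed.

(** Parametrises the circle by a compact interval, on which the extreme value theorem applies. *)
Lemma expi_surj (z : C) : cabs z = 1 -> exists2 t, - pi <= t <= pi & z = expi t.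
Proof.
move=> z1; have xy : cRe z ^+ 2 + cIm z ^+ 2 = 1 by rewrite -cabs_sqr z1 expr1n.
have xb : -1 <= cRe z <= 1 by rewrite -ler_norml -z1 cRe_le.
have cosx : cos (acos (cRe z)) = cRe z by rewrite acosK// in_itv.
have sinx : sin (acos (cRe z)) = `|cIm z|.
  by rewrite sin_acos// -xy addrC addKr sqrtr_sqr.
have t0 := acos_ge0 xb; have t1 := acos_lepi xb.
have p0 := pi_ge0 R.
have [y0|y0] := leP 0 (cIm z).
  exists (acos (cRe z)); first by apply/andP; split; lra.
  by rewrite /expi cosx sinx ger0_norm//; case: (z).
exists (- acos (cRe z)); first by apply/andP; split; lra.
by rewrite /expi cosN sinN cosx sinx ltr0_norm// opprK; case: (z).
Qed.

Lemma power_series_continuous a (h : C -> C) (s e : R) (w : C) :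
  power_series a h -> s < 1 -> cabs w <= s -> 0 < e ->
  exists2 d, 0 < d & forall z, cabs z <= s -> cabs (z - w) <= d ->
    cabs (h z - h w) <= e.
Proof.
move=> ah s1 ws e0.
have e3 : 0 < e / 3 by rewrite divr_gt0.
have [N hN] := power_series_uniform ah s1 e3.
pose P := psum a N.
have /factor_theorem[Q defQ] : root (P - P.[w]%:P) w by rewrite /root !hornerE subrr.
have [K K0 hK] := poly_bounded Q s.
exists (e / 3 / K); first by rewrite divr_gt0.
move=> z zs zw.
have PB : cabs (P.[z] - P.[w]) <= e / 3.
  have -> : P.[z] - P.[w] = Q.[z] * (z - w).
    by have := congr1 (horner^~ z) defQ; rewrite !hornerE.
  by rewrite cabsM -[e / 3](divfK (lt0r_neq0 K0)) mulrC ler_pM ?cabs_ge0 ?hK.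
have -> : e = e / 3 + (e / 3 + e / 3) by field.
apply: le_trans (cabs_subr _ P.[z] _) _; rewrite lerD ?hN//.
apply: le_trans (cabs_subr _ P.[w] _) _; rewrite lerD//.
by rewrite cabsB hN.
Qed.

Lemma circle_lower_bound a (h : C -> C) (r : R) :
  power_series a h -> 0 < r -> r < 1 -> (forall z, cabs z = r -> h z != 0) ->
  exists2 m, 0 < m & forall z, cabs z = r -> m <= cabs (h z).
Proof.
move=> ah r0 r1 hz.
have cr t : cabs (ofreal r * expi t) = r.
  by rewrite cabsM cabs_ofreal cabs_expi mulr1 gtr0_norm.
pose F t := cabs (h (ofreal r * expi t)).
have Fcont : continuous F.
  move=> t; apply/cvgrPdist_le => e e0.
  have ct : cabs (ofreal r * expi t) <= r by rewrite cr.
  have [d d0 hd] := power_series_continuous ah r1 ct e0.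
  have d2 : 0 < d / 2 by rewrite divr_gt0.
  have /cvgrPdist_le/(_ _ d2) cost := @continuous_cos R t.
  have /cvgrPdist_le/(_ _ d2) sint := @continuous_sin R t.
  near=> u.
  have : cabs (h (ofreal r * expi u) - h (ofreal r * expi t)) <= e.
    apply: hd; first by rewrite cr.
    rewrite -mulrBr cabsM cabs_ofreal gtr0_norm//.
    have dist : cabs (expi u - expi t) <= d.
      apply: le_trans (cabs_le_Re_Im _) _; rewrite cReB cImB /cRe /cIm /=.
      rewrite [d](splitr) lerD// distrC.
        by near: u; exact: cost.
      by near: u; exact: sint.
    by rewrite -[d]mul1r ler_pM ?cabs_ge0// ltW.
  move=> H; rewrite /F ler_distl; apply/andP; split.
    by rewrite lerBlDr -lerBlDl (le_trans (cabs_rev _ _)).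
  by rewrite -lerBlDl (le_trans (cabs_rev _ _))// cabsB.
have pile : - pi <= pi :> R by have := pi_ge0 R; lra.
have [t _ ht] := EVT_min pile (continuous_subspaceT Fcont).
exists (F t); first by rewrite cabs_gt0 hz.
move=> z zr; have r' := lt0r_neq0 r0.
have [|u uI zu] := @expi_surj (z / ofreal r).
  by rewrite cabsM cabsV cabs_ofreal zr gtr0_norm ?divff.
have -> : z = ofreal r * expi u.
  by rewrite -zu mulrC divfK// -(rmorph0 (@ofreal R)) (inj_eq (@ofreal_inj R)).
by apply: ht; rewrite in_itv.
Unshelve. all: by end_near.
Qed.

(** The circle is cut by a square grid of mesh [1 / M]. Two points of one cell differ by at most
    [1 / M] in each coordinate, hence by at most [2 / M <= eta]. *)
Lemma circle_net (eta : R) : 0 < eta -> exists us : seq C,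
  (forall u, u \in us -> cabs u = 1) /\
  forall z, cabs z = 1 -> exists2 u, u \in us & cabs (z - u) <= eta.
Proof.
move=> eta0; pose M := (Num.trunc (2 / eta)).+1.
have M0 : 0 < M%:R :> R by rewrite ltr0n.
have MP : 2 / M%:R <= eta.
  by rewrite ler_pdivrMr// mulrC -ler_pdivrMr// ltW// /M truncnS_gt.
pose g (x : R) := Num.trunc (M%:R * (x + 1)).
pose cell k l := [set u : C | cabs u = 1 /\ g (cRe u) = k /\ g (cIm u) = l].
(* For a cell that misses the circle the default is 1, which is still on the circle. *)
pose pick k l : C := xget 1 (cell k l).
pose us := [seq pick k l | k <- iota 0 (M * 2).+1, l <- iota 0 (M * 2).+1].
have gle x : `|x| <= 1 -> (g x < (M * 2).+1)%N /\ 0 <= M%:R * (x + 1).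
  rewrite ler_norml => /andP[x0 x1].
  have nn : 0 <= M%:R * (x + 1) by apply: mulr_ge0; [exact: ltW | lra].
  split => //; rewrite ltnS truncn_le_nat (@le_lt_trans _ _ (M * 2)%:R) ?ltr_nat//.
  by rewrite natrM ler_pM2l//; lra.
have gdist x y : `|x| <= 1 -> `|y| <= 1 -> g x = g y -> `|x - y| <= M%:R^-1.
  move=> /gle[_ x0] /gle[_ y0] gxy.
  have /andP[xa xb] := truncn_itv x0; have /andP[ya yb] := truncn_itv y0.
  move: xa xb; rewrite -/(g x) gxy => xa xb; rewrite -/(g y) in ya yb.
  rewrite -(ler_pM2l M0) mulfV ?lt0r_neq0// -{1}(gtr0_norm M0) -normrM.
  by move: xb yb; rewrite -natr1 mulrBr ler_norml => xb yb; apply/andP; split; lra.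
exists us; split.
  move=> u /allpairsP[[k l] /= [_ _ ->]]; rewrite /pick.
  by case: xgetP => [v _ []//|_]; rewrite cabs1.
move=> z z1.
have Rz : `|cRe z| <= 1 by rewrite -z1 cRe_le.
have Iz : `|cIm z| <= 1 by rewrite -z1 cIm_le.
exists (pick (g (cRe z)) (g (cIm z))).
  by apply/allpairsP; exists (g (cRe z), g (cIm z)); rewrite !mem_iota /= !add0n (gle _ Rz).1 (gle _ Iz).1.
rewrite /pick; case: xgetP => [v _ [v1 [gR gI]]|]; last first.
  by move=> /(_ z); rewrite /cell /= => /(_ (conj z1 (conj erefl erefl))).
apply: le_trans MP; apply: le_trans (cabs_le_Re_Im _) _.
have Rv : `|cRe v| <= 1 by move: (cRe_le v); rewrite v1.
have Iv : `|cIm v| <= 1 by move: (cIm_le v); rewrite v1.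
rewrite cReB cImB -[2]/(1 + 1) mulrDl mul1r lerD// gdist//.
Qed.

End Circles.

(** * Growth of zero-free polynomials *)

Section ZeroFreeGrowth.
Context {R : realType}.
Notation C := (cplx R).

Definition prod_1subX (xs : seq C) : {poly C} := \prod_(x <- xs) (1 - x *: 'X).

Definition power_sum (xs : seq C) i : C := \sum_(x <- xs) x ^+ i.

(* The logarithmic derivative of [prod_1subX xs] is the negated generating
   function of the power sums, here truncated at order [M]. *)
Lemma prod_1subX_deriv xs M : exists Q : {poly C},
  (prod_1subX xs)^`() + (\poly_(i < M) power_sum xs i.+1) * prod_1subX xs = Q * 'X^M.
Proof.
elim: xs => [|x xs [Q IH]].
  exists 0; rewrite mul0r /prod_1subX big_nil derivC add0r mulr1.
  by apply/polyP => i; rewrite coef_poly coef0 /power_sum big_nil if_same.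
set E := prod_1subX xs in IH *.
have -> : prod_1subX (x :: xs) = (1 - x *: 'X) * E by rewrite /prod_1subX big_cons.
have -> : \poly_(i < M) power_sum (x :: xs) i.+1 =
    \poly_(i < M) power_sum xs i.+1 + \poly_(i < M) x ^+ i.+1.
  apply/polyP => i; rewrite coefD !coef_poly /power_sum big_cons.
  by case: ifP => _; rewrite ?addr0// addrC.
have geo : (\poly_(i < M) x ^+ i.+1) * (1 - x *: 'X) = x%:P - (x ^+ M.+1) *: 'X^M.
  have -> : \poly_(i < M) x ^+ i.+1 = x *: \sum_(i < M) (x *: 'X) ^+ i.
    rewrite poly_def scaler_sumr; apply: eq_bigr => i _.
    by rewrite exprZn scalerA exprS.
  rewrite -scalerAl mulrC -opprB mulNr -subrX1 opprB scalerBr exprZn scalerA -exprS.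
  by rewrite alg_polyC.
exists ((1 - x *: 'X) * Q - (x ^+ M.+1)%:P * E).
have -> : ((1 - x *: 'X) * Q - (x ^+ M.+1)%:P * E) * 'X^M =
    (1 - x *: 'X) * (Q * 'X^M) - (x ^+ M.+1)%:P * E * 'X^M by ring.
rewrite -IH derivM derivB derivC derivZ derivX sub0r.
move: geo; set P := \poly_(i < M) power_sum _ _; set G := \poly_(i < M) _ => geo.
have -> : (P + G) * ((1 - x *: 'X) * E) = P * ((1 - x *: 'X) * E) + (G * (1 - x *: 'X)) * E.
  by rewrite mulrDl; congr (_ + _); rewrite mulrA.
rewrite geo -!mul_polyC polyC_exp; ring.
Qed.

(** Coefficient [m] of [prod_1subX_deriv] at order [m.+1], to which the multiple of ['X^(m.+1)]
    contributes nothing. *)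
Lemma newton_identity xs m : (prod_1subX xs)`_m.+1 *+ m.+1 =
  - \sum_(i < m.+1) power_sum xs i.+1 * (prod_1subX xs)`_(m - i).
Proof.
have [Q /(congr1 (fun p : {poly C} => p`_m))] := prod_1subX_deriv xs m.+1.
rewrite coefD coef_deriv coefM coefMXn ltnSn => /eqP; rewrite addr_eq0 => /eqP ->.
by congr (- _); apply: eq_bigr => i _; rewrite coef_poly ltn_ord.
Qed.

Lemma prod_1subX0 xs : (prod_1subX xs)`_0 = 1.
Proof.
rewrite -horner_coef0 horner_prod big1 // => x _.
by rewrite !hornerE subr0.
Qed.

(** Newton's identities give each power sum from the coefficients and the lower power sums. The
    length of [xs] does not enter, so [D] serves all degrees. *)
Lemma power_sum_bound (b : nat -> R) I : exists D, forall xs,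
  (forall m, cabs (prod_1subX xs)`_m <= b m) ->
  forall i, (i < I)%N -> cabs (power_sum xs i.+1) <= D.
Proof.
have b0 xs : (forall m, cabs (prod_1subX xs)`_m <= b m) -> forall m, 0 <= b m.
  by move=> H m; apply: le_trans (H m); exact: cabs_ge0.
elim: I => [|I [D hD]]; first by exists 0.
exists (`|D| + (b I.+1 *+ I.+1 + \sum_(i < I) `|D| * b (I - i)%N)) => xs hb i.
have bn := b0 _ hb.
have tail_ge0 : 0 <= b I.+1 *+ I.+1 + \sum_(i < I) `|D| * b (I - i)%N.
  by rewrite addr_ge0 ?mulrn_wge0 ?sumr_ge0// => k _; rewrite mulr_ge0.
rewrite ltnS leq_eqVlt => /orP[/eqP ->|iI]; last first.
  by rewrite (le_trans (hD xs hb i iI))// (le_trans (ler_norm _))// lerDl.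
have := newton_identity xs I.
rewrite big_ord_recr /= subnn prod_1subX0 mulr1 => N.
have -> : power_sum xs I.+1 = - ((prod_1subX xs)`_I.+1 *+ I.+1) -
    \sum_(i < I) power_sum xs i.+1 * (prod_1subX xs)`_(I - i).
  by rewrite N opprK addrAC subrr add0r.
rewrite ler_wpDl//; apply: le_trans (cabsD _ _) _; rewrite !cabsN lerD//.
  by rewrite -mulr_natr cabsM cabs_nat mulr_natr lerMn2r hb orbT.
apply: le_trans (cabs_sum _ _ _) _; apply: ler_sum => k _.
by rewrite cabsM ler_pM ?cabs_ge0 ?hb// (le_trans (hD xs hb k (ltn_ord k)))// ler_norm.
Qed.

Lemma sum_bin_diag T m : (\sum_(k < m.+1) 'C(T + k, k) = 'C(T.+1 + m, m))%N.
Proof.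
elim: m => [|m IH]; first by rewrite big_ord_recr big_ord0 /= !bin0.
by rewrite big_ord_recr /= IH addnS binS addnC -addSnnS.
Qed.

(** A majorant argument: ['C(T + m, m)] is the coefficient of [z ^ m] in [(1 - z) ^ -(T + 1)], for
    which Newton's recursion has all its power sums replaced by [T + 1]. *)
Lemma coef_le_bin xs (u : R) (T : nat) : 0 <= u ->
  (forall i, cabs (power_sum xs i.+1) * u ^+ i.+1 <= T.+1%:R) ->
  forall m, cabs (prod_1subX xs)`_m * u ^+ m <= 'C(T + m, m)%:R.
Proof.
move=> u0 hS m; elim/ltn_ind: m => -[_|m IH].
  by rewrite prod_1subX0 cabs1 expr0 mulr1 bin0.
have m1 : 0 < m.+1%:R :> R by rewrite ltr0n.
rewrite -(ler_pM2l m1) mulrA -[X in X * _ * _]cabs_nat -cabsM mulr_natl newton_identity.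
rewrite cabsN; apply: le_trans (ler_wpM2r _ (cabs_sum _ _ _)) _; first exact: exprn_ge0.
have -> : m.+1%:R * 'C(T + m.+1, m.+1)%:R =
    \sum_(i < m.+1) T.+1%:R * 'C(T + (m - i), m - i)%:R :> R.
  rewrite -mulr_sumr -natr_sum -!natrM; congr (_%:R).
  rewrite -addSnnS mul_bin_left addnK -sum_bin_diag; congr (_ * _)%N.
  by rewrite (reindex_inj rev_ord_inj); apply: eq_bigr => i _; rewrite /= subSS.
rewrite mulr_suml; apply: ler_sum => i _; rewrite cabsM.
have -> : u ^+ m.+1 = u ^+ i.+1 * u ^+ (m - i).
  by rewrite -exprD; congr (_ ^+ _); have := ltn_ord i; lia.
rewrite mulrACA ler_pM// ?mulr_ge0 ?cabs_ge0 ?exprn_ge0// IH//; have := ltn_ord i; lia.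
Qed.

(** The left side times [(1 - theta) ^ T] is one term of the expansion of
    [((1 - theta) + theta) ^ (T + m) = 1]. *)
Lemma bin_le_expr (theta : R) T m : 0 <= theta -> theta < 1 ->
  'C(T + m, m)%:R * theta ^+ m <= ((1 - theta) ^- T : R).
Proof.
move=> t0 t1; have t1' : 0 < 1 - theta by rewrite subr_gt0.
rewrite -[leRHS]mul1r ler_pdivlMr ?exprn_gt0//.
rewrite [leRHS](_ : 1 = ((1 - theta) + theta) ^+ (T + m)); last by rewrite subrK expr1n.
have mT : (m < (T + m).+1)%N by rewrite ltnS leq_addl.
rewrite [leRHS]exprDn (bigD1 (Ordinal mT)) //= addnK -[X in _ <= X + _]mulr_natl.
rewrite -mulrA [theta ^+ m * _]mulrC lerDl.
by rewrite sumr_ge0// => i _; rewrite mulrn_wge0// mulr_ge0 ?exprn_ge0// ltW.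
Qed.

(** At scale [u = 2 s / 3] the power sum of order [i] is at most [n (2 / 3) ^ i], a small fraction
    of [n] once [i] is large; the lower orders are bounded by a constant. So [coef_le_bin] applies
    with [T] a constant plus a small fraction of [n]. *)
Lemma prod_1subX_growth (M y s e : R) : 0 < y -> 0 < s -> 0 < e ->
  exists2 K, 0 < K & forall n xs, (size xs <= n)%N ->
    (forall x, x \in xs -> cabs x * s <= 1) ->
    (forall m, cabs (prod_1subX xs)`_m * y ^+ m <= M) ->
    forall w, cabs w <= s / 3 -> cabs (prod_1subX xs).[w] <= K * (1 + e) ^+ n.
Proof.
move=> y0 s0 e0.
have e1 : 1 < 1 + e by rewrite ltrDl.
(* The final bound is a constant times [3 ^ T], with [T] about [n / k.+1]; this [k] turns it into
   [(1 + e) ^ n]. *)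
have [k hk] : exists k, 3 <= (1 + e) ^+ k.+1.
  have ie0 : 0 <= (1 + e)^-1 by rewrite invr_ge0; lra.
  have ie1 : (1 + e)^-1 < 1 by rewrite invf_lt1//; lra.
  have [|N hN] := @geometric_small _ _ (3^-1) ie0 ie1; first by rewrite invr_gt0.
  exists N; have := hN N.+1 (leqnSn N); rewrite exprVn lef_pV2 ?posrE//.
  by rewrite exprn_gt0//; lra.
have [I hI] : exists I, forall i, (I <= i)%N -> (2 / 3 : R) ^+ i <= k.+1%:R^-1.
  by apply: geometric_small; rewrite ?invr_gt0//; lra.
have [D hD] := power_sum_bound (fun m => M / y ^+ m) I.
(* [D'] dominates the scaled power sums of order at most [I]; the orders beyond [I] are covered by
   [n / k.+1]. *)
pose D' := (Num.trunc (`|D| * (1 + 2 / 3 * s) ^+ I)).+1.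
exists (4 * 3 ^+ D'.+1); first by rewrite mulr_gt0 ?exprn_gt0.
move=> n xs sz hx hE w hw.
pose u := 2 / 3 * s.
have u0 : 0 <= u by rewrite /u mulr_ge0// ltW.
pose T := (D' + n %/ k.+1)%N.
have hS i : cabs (power_sum xs i.+1) * u ^+ i.+1 <= T.+1%:R.
  have [iI|Ii] := ltnP i I.
    apply: (@le_trans _ _ D'%:R); last by rewrite ler_nat leqW// leq_addr.
    apply/ltW/(le_lt_trans _ (truncnS_gt _)).
    apply: ler_pM; rewrite ?cabs_ge0 ?exprn_ge0//.
      apply: (le_trans _ (ler_norm _)); apply: hD => // m.
      by rewrite ler_pdivlMr ?exprn_gt0.
    apply: (@le_trans _ _ ((1 + u) ^+ i.+1)).
      by rewrite lerXn2r ?nnegrE ?addr_ge0// lerDr.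
    by rewrite ler_weXn2l// lerDl.
  apply: (@le_trans _ _ (n%:R * (2 / 3) ^+ i.+1)).
    rewrite /u [2 / 3 * s]mulrC exprMn mulrA ler_wpM2r ?exprn_ge0//.
    apply: le_trans (ler_wpM2r _ (cabs_sum _ _ _)) _; first by rewrite exprn_ge0 ?ltW.
    rewrite mulr_suml; apply: (@le_trans _ _ (\sum_(x <- xs) 1)).
      rewrite big_seq [leRHS]big_seq; apply: ler_sum => x /hx xs1.
      by rewrite cabsX -exprMn exprn_ile1// mulr_ge0 ?cabs_ge0 ?ltW.
    by rewrite big_const_seq count_predT iter_addr_0 ler_nat.
  apply: (@le_trans _ _ (n%:R / k.+1%:R)); first by rewrite ler_wpM2l// hI// leqW.
  rewrite ler_pdivrMr ?ltr0n// -natrM ler_nat.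
  have := divn_eq n k.+1; have := ltn_pmod n (ltn0Sn k); rewrite /T; nia.
have coef := coef_le_bin u0 hS.
(* Shrinking the radius from [u] by the factor 2/3 replaces the binomial by
   [(1 - 2 / 3) ^ -T = 3 ^ T]. A further factor 3/4 leads to [s / 3] and gives a geometric series of
   sum 4. *)
have coef' m : cabs (prod_1subX xs)`_m * (4 / 9 * s) ^+ m <= 3 ^+ T.
  have -> : 4 / 9 * s = u * (2 / 3) by rewrite /u; field.
  rewrite exprMn mulrA; apply: le_trans (ler_wpM2r _ (coef m)) _; first by rewrite exprn_ge0.
  apply: le_trans (@bin_le_expr (2 / 3) T m _ _) _; [lra|lra|].
  by rewrite (_ : 1 - 2 / 3 = 3^-1) ?exprVn ?invrK//; field.
apply: (@le_trans _ _ (4 * 3 ^+ T)); last first.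
  rewrite /T exprD.
  have : 3 ^+ (n %/ k.+1) <= (1 + e) ^+ n :> R.
    apply: (@le_trans _ _ (((1 + e) ^+ k.+1) ^+ (n %/ k.+1))).
      by rewrite lerXn2r ?nnegrE// exprn_ge0//; lra.
    by rewrite -exprM ler_weXn2l ?ltW// mulnC leq_trunc_div.
  move=> h; rewrite -mulrA ler_pM2l// ler_pM ?exprn_ge0//.
  by rewrite ler_weXn2l ?ler1n.
rewrite horner_coef (le_trans (cabs_sum _ _ _))//.
set N := size _.
apply: (@le_trans _ _ (\sum_(i < N) 3 ^+ T * (3 / 4) ^+ i)).
  apply: ler_sum => i _; rewrite cabsM cabsX.
  apply: (@le_trans _ _ (cabs (prod_1subX xs)`_i * (s / 3) ^+ i)).
    by rewrite ler_wpM2l ?cabs_ge0// lerXn2r ?nnegrE ?cabs_ge0 ?divr_ge0// ltW.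
  have -> : s / 3 = (4 / 9 * s) * (3 / 4) by field.
  by rewrite exprMn mulrA ler_wpM2r ?exprn_ge0.
rewrite -mulr_sumr mulrC ler_wpM2r ?exprn_ge0//.
have : (1 - 3 / 4 : R) * \sum_(i < N) (3 / 4) ^+ i <= 1.
  by rewrite -opprB mulNr -subrX1 opprB lerBlDr lerDl exprn_ge0.
by lra.
Qed.

(** The [xs] are the inverses of [z - a] over the zeros [z] of [p], with multiplicity. *)
Lemma factor_at (p : {poly C}) a s n : 0 < s -> (size p <= n.+1)%N -> p != 0 ->
  (forall z, cabs (z - a) < s -> ~~ root p z) ->
  exists xs, [/\ (size xs <= n)%N, forall x, x \in xs -> cabs x * s <= 1 &
    forall w, p.[a + w] = p.[a] * (prod_1subX xs).[w]].
Proof.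
move=> s0 sz p0 hz; have [zs defp] := closed_field_poly_normal p.
have lp0 : lead_coef p != 0 by rewrite lead_coef_eq0.
have rz z : z \in zs -> s <= cabs (z - a).
  move=> zzs; rewrite leNgt; apply/negP => /hz.
  by rewrite defp rootZ// root_prod_XsubC zzs.
exists [seq (z - a)^-1 | z <- zs]; split.
- rewrite size_map -ltnS -(size_prod_XsubC zs id) -(size_scale _ lp0) -defp //.
- move=> x /mapP[z /rz zs' ->]; rewrite cabsV mulrC ler_pdivrMr ?mul1r//.
  exact: lt_le_trans zs'.
move=> w; rewrite defp !hornerZ -mulrA; congr (_ * _).
rewrite /prod_1subX big_map !horner_prod -big_split /=.
rewrite big_seq [RHS]big_seq; apply: eq_bigr => z /rz zs'.
have za : z - a != 0 by rewrite -cabs_gt0 (lt_le_trans s0).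
by rewrite !hornerE; field.
Qed.

Lemma zero_free_growth (zeta a : C) (delta y B c e : R) :
  0 < delta -> cabs (a - zeta) <= delta / 8 -> 0 < y -> 0 < c -> 0 < e ->
  exists2 K, 0 < K & forall n (p : {poly C}), (size p <= n.+1)%N ->
    (forall z, cabs (z - zeta) < delta -> ~~ root p z) ->
    c <= cabs p.[a] -> (forall z, cabs (z - a) <= y -> cabs p.[z] <= B) ->
    forall z, cabs (z - zeta) <= delta / 8 -> cabs p.[z] <= K * (1 + e) ^+ n.
Proof.
move=> d0 ha y0 c0 e0.
(* The disk of radius [s] about [a] stays in the zero-free one, and the target disk lies within
   [delta / 8 + delta / 8 <= s / 3] of [a]. *)
pose s := 7 / 8 * delta.
have s0 : 0 < s by rewrite /s mulr_gt0//.
have [K K0 hK] := prod_1subX_growth (B / c) y0 s0 e0.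
exists (`|B| * K + 1); first by rewrite ltr_wpDl// mulr_ge0// ltW.
move=> n p sz hz pa hB z hz'.
have p0 : p != 0 by apply/eqP => p0; move: pa; rewrite p0 horner0 cabs0 leNgt c0.
have pa0 : 0 < cabs p.[a] by exact: lt_le_trans pa.
have paB : cabs p.[a] <= B by apply: hB; rewrite subrr cabs0 ltW.
have [|xs [sxs hxs hp]] := @factor_at p a s n s0 sz p0.
  move=> v hv; apply: hz; apply: le_lt_trans (cabs_subr _ a _) _.
  by move: hv; rewrite /s; lra.
have cE m : cabs (prod_1subX xs)`_m * y ^+ m <= B / c.
  apply: cauchy_estimate (ltW y0) _ => v hv.
  have : cabs (p.[a] * (prod_1subX xs).[v]) <= B by rewrite -hp hB// addrAC subrr add0r hv.
  rewrite cabsM ler_pdivlMr// => H; apply: le_trans H; rewrite mulrC.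
  by rewrite ler_wpM2r ?cabs_ge0.
rewrite -[z](subrK a) addrC hp cabsM.
apply: (@le_trans _ _ (`|B| * (K * (1 + e) ^+ n))).
  rewrite ler_pM ?cabs_ge0//; first by rewrite (le_trans paB)// ler_norm.
  apply: hK => //; apply: le_trans (cabs_subr _ zeta _) _.
  by rewrite (cabsB zeta) /s; lra.
by rewrite mulrA ler_wpM2r ?lerDl// exprn_ge0//; lra.
Qed.

End ZeroFreeGrowth.

(** * Exponential decay of the leading coefficients *)

Section LeadingCoefficient.
Context {R : realType}.
Notation C := (cplx R).

Lemma bernoulli (x : R) k : 0 <= x -> x <= 1 -> 1 - k%:R * x <= (1 - x) ^+ k.
Proof.
move=> x0 x1; elim: k => [|k IH]; first by rewrite mul0r subr0 expr0.
have x1' : 0 <= 1 - x by rewrite subr_ge0.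
rewrite exprS -natr1; apply: le_trans (ler_wpM2l x1' IH).
have : 0 <= k%:R * x * x by rewrite !mulr_ge0.
lra.
Qed.

(** Stands in for a [k]-th root: it makes [r ^ k] exceed a given rate, and also carries a rate for
    [k]-th powers back to the quantity itself. *)
Lemma expr_above (q : R) k : q < 1 -> exists2 r, 0 < r < 1 & q < r ^+ k.
Proof.
move=> q1; have [m [m0 m1 qm]] : exists m, [/\ 0 <= m, m < 1 & q <= m].
  exists (Num.max q 0); split; rewrite ?gt_max ?le_max ?lexx ?orbT// q1 ltr01 //.
have k0 : 0 < k.+2%:R :> R by rewrite ltr0n.
(* The denominator exceeds [k] so that Bernoulli's [1 - k x] is strictly above [m], and [x < 1] even
   for [k = 0]. *)
pose x := (1 - m) / k.+2%:R.
have x0 : 0 < x by rewrite divr_gt0// subr_gt0.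
have x1 : x < 1 by rewrite ltr_pdivrMr// mul1r -natr1 -natr1; have := ler0n R k; lra.
exists (1 - x); first by apply/andP; split; lra.
apply: le_lt_trans qm _; apply: lt_le_trans (bernoulli k (ltW x0) (ltW x1)).
have xk : x * k.+2%:R = 1 - m by rewrite divfK ?lt0r_neq0.
by move: xk; rewrite -natr1 -natr1; lra.
Qed.

(** Reversal is relative to the nominal degree [n], so the value at 0 is the coefficient of index
    [n] even when that coefficient vanishes. *)
Definition revpoly n (p : {poly C}) : {poly C} := \poly_(i < n.+1) p`_(n - i).

Lemma revpolyE n (p : {poly C}) w : (size p <= n.+1)%N -> w != 0 ->
  (revpoly n p).[w] = w ^+ n * p.[w^-1].
Proof.
move=> sz w0; rewrite /revpoly horner_poly (horner_coef_wide _ sz) mulr_sumr.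
rewrite (reindex_inj rev_ord_inj) /=; apply: eq_bigr => i _.
have ni : (i <= n)%N by rewrite -ltnS.
rewrite subSS subKn// mulrCA; congr (_ * _).
apply: (mulIf (expf_neq0 i w0)).
by rewrite exprVn divfK ?expf_neq0// -exprD subnK.
Qed.

Lemma geometric_sum_le (x : R) N : 0 <= x -> x < 1 ->
  \sum_(i < N) x ^+ i <= (1 - x)^-1.
Proof.
move=> x0 x1; have x1' : 0 < 1 - x by rewrite subr_gt0.
rewrite -[leRHS]mul1r ler_pdivlMr// mulrC -opprB mulNr -subrX1 opprB.
by rewrite lerBlDr lerDl exprn_ge0.
Qed.

(* Bounds the product of the rotates of the reversed polynomial on a circle of
   radius less than 1: one factor is small, and the others grow arbitrarily
   slowly. *)
Lemma leading_coef_decay (p : nat -> {poly C}) (zeta : C) (eta : R) n0 :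
  cabs zeta = 1 -> 0 < eta -> (forall n, size (p n) <= n.+1)%N ->
  (forall e, 0 < e -> exists2 K, 0 < K & forall n, (n0 <= n)%N ->
     forall z, cabs (z - zeta) <= eta -> cabs (p n).[z] <= K * (1 + e) ^+ n) ->
  (forall r, 0 < r < 1 -> exists K, forall n j, cabs (p n)`_j * r ^+ j <= K) ->
  exists2 q, 0 < q < 1 & exists2 K, 0 < K &
    forall n, (n0 <= n)%N -> cabs (p n)`_n <= K * q ^+ n.
Proof.
move=> zeta1 eta0 sz near_bound coef_bound.
have zeta0 : zeta != 0 by rewrite -cabs_gt0 zeta1.
(* For [|w| = rho] the point [1 / w] lies at distance [eta / 2] outside the unit circle, which
   leaves room for an angular error within [eta]. *)
pose R0 := 1 + eta / 2; pose rho := R0^-1.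
have R01 : 1 < R0 by rewrite /R0 ltrDl divr_gt0.
have R00 : 0 < R0 by apply: lt_trans R01.
have rho0 : 0 < rho by rewrite invr_gt0.
have rho1 : rho < 1 by rewrite invf_lt1.
have eta4 : 0 < eta / 4 by rewrite divr_gt0.
have [us [us1 net]] := circle_net eta4.
have us0 u : u \in us -> u != 0 by move=> /us1 u1; rewrite -cabs_gt0 u1.
pose k := size us.
have k0 : (0 < k)%N.
  by have [u] := net _ zeta1; rewrite /k; case: (us).
(* The rate on the good arc: [rho ^ n] against growth [(1 + eta / 4) ^ n], which is still below 1
   because [1 + eta / 4 < R0]. *)
have [q1 q1E] : exists q1, q1 = rho * (1 + eta / 4) by eexists.
have q10 : 0 < q1 by rewrite q1E mulr_gt0// addr_gt0.
have q11 : q1 < 1 by rewrite q1E mulrC ltr_pdivrMr// mul1r /R0; lra.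
have [K K0 hK] := near_bound _ eta4.
(* The [k] factors together may lose [r ^ -(k n)]; this [r] keeps the product at the rate
   [q1 / r ^ k < 1]. *)
have [r r01 hr] := expr_above k q11.
have /andP[r0 r1] := r01.
have [B hB] := coef_bound r r01.
pose B' := 1 + `|B| / (1 - rho).
have rho1' : 0 < 1 - rho by rewrite subr_gt0.
have B'1 : 1 <= B' by rewrite lerDl divr_ge0// ltW.
have B'0 : 0 < B' by apply: lt_le_trans B'1.
have rn1 n : 1 <= r ^- n by rewrite -exprVn exprn_ege1// invf_ge1// ltW.
have hall n w : cabs w = rho -> cabs (revpoly n (p n)).[w] <= B' * r ^- n.
  move=> wr; rewrite horner_poly (le_trans (cabs_sum _ _ _))//.
  apply: (@le_trans _ _ (\sum_(i < n.+1) `|B| * r ^- n * rho ^+ i)).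
    apply: ler_sum => i _; rewrite cabsM cabsX wr ler_wpM2r//; first by rewrite exprn_ge0// ltW.
    have ni : (i <= n)%N by rewrite -ltnS.
    rewrite ler_pdivlMr ?exprn_gt0//; apply: le_trans (ler_norm B).
    apply: le_trans (hB n (n - i)%N); rewrite ler_wpM2l ?cabs_ge0//.
    by rewrite ler_wiXn2l ?ltW// leq_subr.
  rewrite -mulr_sumr mulrAC ler_wpM2r//; first by rewrite (le_trans _ (rn1 n)).
  rewrite ler_wpDl// ler_wpM2l// geometric_sum_le// ltW//.
have hnear n w : (n0 <= n)%N -> cabs w = rho -> cabs (w^-1 - zeta) <= eta ->
    cabs (revpoly n (p n)).[w] <= K * q1 ^+ n.
  move=> nn wr wz; rewrite revpolyE//; last by rewrite -cabs_gt0 wr.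
  rewrite cabsM cabsX wr q1E exprMn mulrCA ler_pM2l ?exprn_gt0// hK//.
have [q2 q2E] : exists q2, q2 = q1 / r ^+ k by eexists.
have rk0 : 0 < r ^+ k by rewrite exprn_gt0.
have q21 : q2 < 1 by rewrite q2E ltr_pdivrMr// mul1r.
have bound n : (n0 <= n)%N -> cabs (p n)`_n ^+ k <= (K * B' ^+ k) * q2 ^+ n.
  move=> nn; pose Q := \prod_(u <- us) (revpoly n (p n) \Po (u *: 'X)).
  have QE w : Q.[w] = \prod_(u <- us) (revpoly n (p n)).[u * w].
    by rewrite horner_prod; apply: eq_bigr => u _; rewrite horner_comp !hornerE.
  have -> : cabs (p n)`_n ^+ k = cabs Q.[0].
    rewrite QE cabs_prod (eq_bigr (fun=> cabs (p n)`_n)); last first.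
      by move=> u _; rewrite mulr0 horner_coef0 coef_poly /= subn0.
    by rewrite big_const_seq count_predT iter_mulr_1.
  apply: (mean_value_bound (ltW rho0)) => w wr.
  have w0 : w != 0 by rewrite -cabs_gt0 wr.
  (* The rotation [u] is picked so that [1 / (u w)] points nearly in the direction of [zeta]. *)
  have [|u uus hu] := net ((ofreal rho / w) / zeta).
    by rewrite !cabsM !cabsV zeta1 wr cabs_ofreal gtr0_norm// invr1 mulr1 divff ?lt0r_neq0.
  have u0 := us0 _ uus; have cu := us1 _ uus.
  have rhoC : ofreal rho != 0 by rewrite -cabs_gt0 cabs_ofreal gtr0_norm.
  have uwz : cabs ((u * w)^-1 - zeta) <= eta.
    have [th thE] : exists th, th = ofreal rho / w by eexists.
    have cth : cabs th = 1 by rewrite thE cabsM cabsV wr cabs_ofreal gtr0_norm ?divff ?lt0r_neq0.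
    (* Splits the distance into a radial part [eta / 2] and an angular part at most [eta / 4]. *)
    have -> : (u * w)^-1 - zeta = ofreal (eta / 2) * (th / u) + zeta / u * (th / zeta - u).
      have -> : ofreal (eta / 2) = (ofreal rho)^-1 - 1.
        rewrite -fmorphV /rho invrK /R0 rmorphD rmorph1; ring.
      rewrite thE; field; rewrite rhoC; do ?[apply/andP; split] => //.
    apply: le_trans (cabsD _ _) _; rewrite !cabsM !cabsV cth cu zeta1 invr1 !mulr1 mul1r.
    by rewrite cabs_ofreal gtr0_norm ?divr_gt0//; move: hu; rewrite -thE; lra.
  rewrite QE cabs_prod (perm_big _ (perm_to_rem uus)) /= big_cons.
  have cu' v : v \in us -> cabs (v * w) = rho by move=> /us1 v1; rewrite cabsM v1 mul1r.
  have h1 := hnear n (u * w) nn (cu' _ uus) uwz.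
  have h2 : \prod_(v <- rem u us) cabs (revpoly n (p n)).[v * w] <= (B' * r ^- n) ^+ k.
    apply: (@le_trans _ _ ((B' * r ^- n) ^+ size (rem u us))).
      rewrite -(count_predT (rem u us)) -[leRHS]mulr1 -iter_mulr -big_const_seq.
      rewrite big_seq [leRHS]big_seq ler_prod// => v /mem_rem vus.
      by rewrite cabs_ge0 hall ?cu'.
    rewrite ler_weXn2l//; first by rewrite mulr_ege1.
    by rewrite size_rem// leq_pred.
  apply: le_trans (ler_pM (cabs_ge0 _) _ h1 h2) _.
    by rewrite prodr_ge0// => v _; exact: cabs_ge0.
  have rE : (r ^- n) ^+ k = (r ^+ k)^-1 ^+ n.
    by rewrite -!exprVn -!exprM mulnC.
  rewrite exprMn rE q2E exprMn.
  by rewrite le_eqVlt; apply/orP; left; apply/eqP; ring.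
(* So far the [k]-th power of the leading coefficient is bounded; [q2 < q ^ k] lets one compare
   [k]-th powers. *)
have [q /andP[q0 q1'] hq] := expr_above k q21.
exists q; first by rewrite q0 q1'.
pose A := 1 + K * B' ^+ k.
have KB0 : 0 < K * B' ^+ k by rewrite mulr_gt0// exprn_gt0.
have A1 : 1 <= A by rewrite /A lerDl ltW.
exists A; first by apply: lt_le_trans A1.
move=> n nn; rewrite -(@ler_pXn2r _ k)// ?nnegrE ?cabs_ge0//; last first.
  by rewrite mulr_ge0 ?exprn_ge0 ?ltW// (lt_le_trans _ A1).
apply: le_trans (bound n nn) _; rewrite exprMn.
have q20 : 0 <= q2 by rewrite q2E divr_ge0// ltW.
apply: ler_pM; rewrite ?exprn_ge0 ?(ltW KB0)//.
  apply: (@le_trans _ _ A); first by rewrite lerDr.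
  by rewrite -[leLHS]expr1 ler_weXn2l.
by rewrite exprAC lerXn2r ?nnegrE ?exprn_ge0// ltW.
Qed.

End LeadingCoefficient.

(** * Analytic limits of geometrically convergent polynomials *)

Section PolynomialLimits.
Context {R : realType}.
Notation C := (cplx R).

Lemma posC (e : C) : 0 < e -> exists2 r : R, 0 < r & e = ofreal r.
Proof.
move=> e0; exists (cabs e); first by rewrite cabs_gt0 gt_eqF.
by rewrite -normE gtr0_norm.
Qed.

Lemma derivable_quadratic (g : C -> C) (z D : C) (A d : R) : 0 < d ->
  (forall t, cabs t <= d -> cabs (g (z + t) - g z - t * D) <= A * cabs t ^+ 2) ->
  derivable (g : C^o -> C^o) z 1.
Proof.
move=> d0 hg; apply/cvg_ex; exists (D : C^o); apply/cvgrPdist_le => e /posC[r r0 ->].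
have A0 : 0 < 1 + `|A| by rewrite ltr_pwDl.
have d0' : 0 < ofreal d by rewrite -(rmorph0 (@ofreal R)) ofreal_lt.
have e0' : 0 < ofreal (r / (1 + `|A|)).
  by rewrite -(rmorph0 (@ofreal R)) ofreal_lt divr_gt0.
near=> t.
have t0 : t != 0 by near: t; exact: nbhs_dnbhs_neq.
have td : cabs t <= d.
  by rewrite -ofreal_le -normE; near: t; exact: dnbhs0_le.
have te : cabs t <= r / (1 + `|A|).
  by rewrite -ofreal_le -normE; near: t; exact: dnbhs0_le.
rewrite normE ofreal_le /= cabsB.
have -> : t^-1 *: (g (t *: 1 + z) - g z) - D = t^-1 * (g (z + t) - g z - t * D).
  have -> : t *: (1 : C^o) + z = z + t by rewrite addrC; congr (_ + _); exact: mulr1.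
  by rewrite mulrBr mulKf.
have ct : 0 < cabs t by rewrite cabs_gt0.
rewrite cabsM cabsV mulrC ler_pdivrMr// (le_trans (hg t td))//.
rewrite expr2 mulrA ler_pM2r//.
apply: (@le_trans _ _ ((1 + `|A|) * cabs t)); last by rewrite mulrC -ler_pdivlMr.
by rewrite ler_pM2r// ler_wpDl// ler_norm.
Unshelve. all: by end_near.
Qed.

(** Nested intervals: [L] is such that [L q ^ n - L q ^ n.+1 = K q ^ n], so [x n - L q ^ n]
    increases and [x n + L q ^ n] decreases. The supremum of the former is the limit, with an
    explicit rate. *)
Lemma geometric_cauchy_real (x : nat -> R) (K q : R) : 0 <= K -> 0 <= q -> q < 1 ->
  (forall n, `|x n.+1 - x n| <= K * q ^+ n) ->
  exists l, forall n, `|l - x n| <= K / (1 - q) * q ^+ n.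
Proof.
move=> K0 q0 q1 hx; set L := K / (1 - q).
have q1' : 0 < 1 - q by rewrite subr_gt0.
have LE n : L * q ^+ n - L * q ^+ n.+1 = K * q ^+ n.
  by rewrite exprS /L; field; rewrite lt0r_neq0.
have L0 : 0 <= L by rewrite divr_ge0// ltW.
clearbody L.
pose y n := x n - L * q ^+ n; pose z n := x n + L * q ^+ n.
have yS n : y n <= y n.+1.
  by have := hx n; have := LE n; rewrite ler_norml /y => ? /andP[? ?]; lra.
have zS n : z n.+1 <= z n.
  by have := hx n; have := LE n; rewrite ler_norml /z => ? /andP[? ?]; lra.
have ymono m n : (m <= n)%N -> y m <= y n by have /nondecreasing_seqP := yS; apply.
have zmono m n : (m <= n)%N -> z n <= z m by have /nonincreasing_seqP := zS; apply.
have yz m n : y m <= z n.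
  apply: (@le_trans _ _ (y (maxn m n))); first by rewrite ymono// leq_maxl.
  apply: (@le_trans _ _ (z (maxn m n))); last by rewrite zmono// leq_maxr.
  have : 0 <= L * q ^+ maxn m n by rewrite mulr_ge0 ?exprn_ge0.
  by rewrite /y /z; lra.
exists (sup (range y)) => n.
rewrite ler_norml.
have h1 : y n <= sup (range y).
  apply: ub_le_sup; last by exists n.
  by exists (z 0%N) => _ [m _ <-].
have h2 : sup (range y) <= z n.
  apply: ge_sup; first by exists (y 0%N), 0%N.
  by move=> _ [m _ <-].
by apply/andP; split; [move: h1; rewrite /y|move: h2; rewrite /z]; lra.
Qed.

Lemma geometric_cauchy (x : nat -> C) (K q : R) : 0 <= K -> 0 <= q -> q < 1 ->
  (forall n, cabs (x n.+1 - x n) <= K * q ^+ n) ->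
  exists l, forall n, cabs (l - x n) <= 2 * K / (1 - q) * q ^+ n.
Proof.
move=> K0 q0 q1 hx.
have [|a ha] := @geometric_cauchy_real (fun n => cRe (x n)) K q K0 q0 q1.
  by move=> n; rewrite -cReB (le_trans (cRe_le _)).
have [|b hb] := @geometric_cauchy_real (fun n => cIm (x n)) K q K0 q0 q1.
  by move=> n; rewrite -cImB (le_trans (cIm_le _)).
exists (Complex a b) => n; apply: le_trans (cabs_le_Re_Im _) _.
rewrite cReB cImB; have := ha n; have := hb n; rewrite /cRe /cIm /=; lra.
Qed.

(** With [x < y ^ 3], two factors [y ^ j] absorb the square, as [j.+1 y ^ j <= 1 + y + ... + y ^ j];
    the third leaves a geometric series. *)
Lemma sqr_geometric_sum (x : R) : 0 <= x -> x < 1 ->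
  exists2 L, 0 < L & forall N, \sum_(j < N) j.+1%:R ^+ 2 * x ^+ j <= L.
Proof.
move=> x0 x1; have [y /andP[y0 y1] hy] := @expr_above _ x 3 x1.
have y1' : 0 < 1 - y by rewrite subr_gt0.
have jy j : j.+1%:R * y ^+ j <= (1 - y)^-1.
  apply: le_trans (geometric_sum_le j.+1 (ltW y0) y1).
  rewrite -[X in X%:R](card_ord j.+1) mulr_natl -sumr_const; apply: ler_sum => i _.
  by rewrite ler_wiXn2l ?ltW// -ltnS.
exists ((1 - y)^-1 ^+ 3); first by rewrite exprn_gt0// invr_gt0.
move=> N; apply: (@le_trans _ _ (\sum_(j < N) (1 - y)^-1 ^+ 2 * y ^+ j)).
  apply: ler_sum => j _.
  apply: (@le_trans _ _ ((j.+1%:R * y ^+ j) ^+ 2 * y ^+ j)).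
    rewrite exprMn -[leRHS]mulrA ler_wpM2l ?exprn_ge0// -exprM -exprD.
    apply: (@le_trans _ _ ((y ^+ 3) ^+ j)); last by rewrite -exprM (_ : 3 * j = j * 2 + j)%N//; lia.
    by apply: lerXn2r; rewrite ?nnegrE ?exprn_ge0// ltW.
  have y0' := ltW y0; have i0 : 0 <= (1 - y)^-1 by rewrite invr_ge0 ltW.
  by rewrite ler_wpM2r ?exprn_ge0// lerXn2r ?nnegrE// mulr_ge0 ?exprn_ge0.
rewrite -mulr_sumr [leRHS]exprSr ler_wpM2l//; first by rewrite exprn_ge0// invr_ge0 ltW.
exact: geometric_sum_le (ltW y0) y1.
Qed.

(** The remainder at [j.+1] is [z + t] times the one at [j] plus a term in [t ^ 2]. The crude factor
    [j ^ 2] suffices, since it will be summed against geometric decay. *)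
Lemma expr_taylor2 (z t : C) (rho : R) j : 1 <= rho -> cabs z <= rho ->
  cabs (z + t) <= rho ->
  cabs ((z + t) ^+ j - z ^+ j - t * (z ^+ j.-1 *+ j)) <= j%:R ^+ 2 * rho ^+ j * cabs t ^+ 2.
Proof.
move=> rho1 zr ztr; have rho0 : 0 <= rho by apply: le_trans rho1.
elim: j => [|j IH].
  by rewrite !expr0 subrr mulr0n mulr0 subrr cabs0 !mulr_ge0 ?exprn_ge0 ?cabs_ge0.
have -> : (z + t) ^+ j.+1 - z ^+ j.+1 - t * (z ^+ j.+1.-1 *+ j.+1) =
    (z + t) * ((z + t) ^+ j - z ^+ j - t * (z ^+ j.-1 *+ j)) +
    t ^+ 2 * (z ^+ j.-1 *+ j).
  case: j {IH} => [|j] /=; first by rewrite mulr0n mulr1n !expr0 !expr1; ring.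
  have -> : z ^+ j.+1 *+ j.+2 = z ^+ j.+1 + z * (z ^+ j *+ j.+1).
    by rewrite mulrnAr -exprS -mulrS.
  rewrite [(z + t) ^+ j.+2]exprS [z ^+ j.+2]exprS [z ^+ j.+1]exprS.
  move: ((z + t) ^+ j.+1) (z ^+ j *+ j.+1) (z ^+ j) => X W Y.
  by ring.
apply: le_trans (cabsD _ _) _.
apply: (@le_trans _ _ (rho * (j%:R ^+ 2 * rho ^+ j * cabs t ^+ 2) +
    cabs t ^+ 2 * (rho ^+ j.+1 * j%:R))).
  rewrite lerD// cabsM.
    by rewrite ler_pM ?cabs_ge0.
  rewrite cabsX ler_wpM2l ?exprn_ge0 ?cabs_ge0// -mulr_natr cabsM cabs_nat ler_wpM2r//.
  rewrite cabsX (le_trans (_ : _ <= rho ^+ j.-1))//.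
    by rewrite lerXn2r ?nnegrE ?cabs_ge0.
  by rewrite ler_weXn2l//; case: (j) => // i; rewrite /= leqW.
have -> : rho * (j%:R ^+ 2 * rho ^+ j * cabs t ^+ 2) + cabs t ^+ 2 * (rho ^+ j.+1 * j%:R)
   = (j%:R ^+ 2 + j%:R) * (rho ^+ j.+1 * cabs t ^+ 2) by rewrite [rho ^+ j.+1]exprS; ring.
rewrite -mulrA ler_wpM2r//; first by rewrite mulr_ge0 ?exprn_ge0 ?cabs_ge0.
by rewrite -natr1; have := ler0n R j; lra.
Qed.

Lemma polynomial_limit_analytic (p : nat -> {poly C}) (K q R0 : R) :
  0 <= K -> 0 <= q -> q < 1 -> 1 < R0 ->
  (forall n j, cabs ((p n.+1)`_j - (p n)`_j) * R0 ^+ j <= K * q ^+ n) ->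
  exists r g, [/\ 1 < r, analytic_in_disk r g &
    forall z, cabs z < r -> forall e, 0 < e ->
      exists N, forall n, (N <= n)%N -> cabs (g z - (p n).[z]) <= e].
Proof.
move=> K0 q0 q1 R01 hp.
have R00 : 0 < R0 by apply: lt_trans R01.
(* The gap between [rho] and [R0] makes sums with terms [j.+1 ^ 2 (rho / R0) ^ j] converge. *)
pose rho := (1 + R0) / 2.
have rho1 : 1 < rho by rewrite /rho; lra.
have rhoR : rho < R0 by rewrite /rho; lra.
have rho0 : 0 < rho by apply: lt_trans rho1.
have x0 : 0 <= rho / R0 by rewrite divr_ge0// ltW.
have x1 : rho / R0 < 1 by rewrite ltr_pdivrMr// mul1r.
have [L L0 hL] := sqr_geometric_sum x0 x1.
have R0n j : 0 < R0 ^+ j by rewrite exprn_gt0.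
have q1' : 0 < 1 - q by rewrite subr_gt0.
(* Coefficientwise domination by [j.+1 ^ 2] covers the values, the derivatives
   and the second order Taylor remainders at once. *)
have dom (u : {poly C}) (v : nat -> C) (M : R) N : 0 <= M ->
    (forall j, cabs u`_j * R0 ^+ j <= M) ->
    (forall j, cabs (v j) <= j.+1%:R ^+ 2 * rho ^+ j) ->
    cabs (\sum_(j < N) u`_j * v j) <= M * L.
  move=> M0 hu hv; apply: le_trans (cabs_sum _ _ _) _.
  apply: (@le_trans _ _ (M * \sum_(j < N) j.+1%:R ^+ 2 * (rho / R0) ^+ j)); last first.
    by rewrite ler_wpM2l.
  rewrite mulr_sumr; apply: ler_sum => j _; rewrite cabsM.
  apply: le_trans (ler_wpM2l (cabs_ge0 _) (hv j)) _.
  have -> : M * (j.+1%:R ^+ 2 * (rho / R0) ^+ j) = M / R0 ^+ j * (j.+1%:R ^+ 2 * rho ^+ j).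
    by rewrite expr_div_n; ring.
  rewrite ler_wpM2r//; first by rewrite mulr_ge0 ?exprn_ge0// ltW.
  by rewrite ler_pdivlMr.
pose N0 n := maxn (size (p n.+1)) (size (p n)).
have evalE (v : nat -> C) n : (\sum_(j < size (p n.+1)) (p n.+1)`_j * v j) -
    (\sum_(j < size (p n)) (p n)`_j * v j) =
    \sum_(j < N0 n) (p n.+1 - p n)`_j * v j.
  have widen (u : {poly C}) m : (size u <= m)%N ->
      \sum_(j < size u) u`_j * v j = \sum_(j < m) u`_j * v j.
    move=> um; rewrite (big_ord_widen m (fun j => u`_j * v j) um) big_mkcond /=.
    apply: eq_bigr => j _; case: ifP => // /negbT; rewrite -leqNgt => uj.
    by rewrite nth_default// mul0r.
  rewrite (widen _ (N0 n)) ?leq_maxl// (widen (p n) (N0 n)) ?leq_maxr// -sumrB.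
  by apply: eq_bigr => j _; rewrite coefB mulrBl.
(* Used twice: with [z ^ j] it produces [g z], and with [j z ^ (j - 1)] its derivative. *)
have conv (v : nat -> C) : (forall j, cabs (v j) <= j.+1%:R ^+ 2 * rho ^+ j) ->
    exists l, forall n, cabs (l - \sum_(j < size (p n)) (p n)`_j * v j)
      <= 2 * (K * L) / (1 - q) * q ^+ n.
  move=> hv; apply: geometric_cauchy => //; first by rewrite mulr_ge0// ltW.
  move=> n; rewrite evalE mulrAC; apply: dom => //; first by rewrite mulr_ge0 ?exprn_ge0.
  by move=> j; rewrite coefB.
have powv z : cabs z <= rho -> forall j, cabs (z ^+ j) <= j.+1%:R ^+ 2 * rho ^+ j.
  move=> zr j; rewrite cabsX; apply: (@le_trans _ _ (rho ^+ j)).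
    by rewrite lerXn2r ?nnegrE ?cabs_ge0// ltW.
  by rewrite ler_peMl ?exprn_ge0 ?(ltW rho0)// exprn_ege1// ler1n.
have derv z : cabs z <= rho -> forall j, cabs (z ^+ j.-1 *+ j) <= j.+1%:R ^+ 2 * rho ^+ j.
  move=> zr j; rewrite -mulr_natl cabsM cabs_nat cabsX ler_pM ?exprn_ge0 ?cabs_ge0//.
    by rewrite (@le_trans _ _ j.+1%:R)// ?ler_nat// expr2 ler_peMl// ler1n.
  apply: (@le_trans _ _ (rho ^+ j.-1)); first by rewrite lerXn2r ?nnegrE ?cabs_ge0// ltW.
  by rewrite ler_weXn2l ?(ltW rho1)// leq_pred.
have hE n z : (p n).[z] = \sum_(j < size (p n)) (p n)`_j * z ^+ j by rewrite horner_coef.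
have /choice[g hg] z : exists l, cabs z <= rho ->
    forall n, cabs (l - (p n).[z]) <= 2 * (K * L) / (1 - q) * q ^+ n.
  have [zr|_] := boolP (cabs z <= rho); last by exists 0.
  by have [l hl] := conv _ (powv z zr); exists l => _ n; rewrite hE.
have KL0 : 0 <= 2 * (K * L) / (1 - q).
  by rewrite divr_ge0 ?(ltW q1')// mulr_ge0// mulr_ge0// ltW.
have small c e : 0 < e -> 0 <= c -> exists N, forall n, (N <= n)%N -> c * q ^+ n <= e.
  move=> e0 c0; have [|N hN] := @geometric_small _ q (e / (1 + c)) q0 q1.
    by rewrite divr_gt0// ltr_pwDl.
  exists N => n Nn; apply: (@le_trans _ _ ((1 + c) * q ^+ n)).
    by rewrite ler_wpM2r ?exprn_ge0// lerDr.
  by rewrite mulrC -ler_pdivlMr ?hN// ltr_pwDl.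
have cvg z : cabs z <= rho -> forall e, 0 < e ->
    exists N, forall n, (N <= n)%N -> cabs (g z - (p n).[z]) <= e.
  move=> zr e e0; have [N hN] := small _ e e0 KL0; exists N => n /hN.
  exact/le_trans/(hg z zr).
have [B B0 hB] : exists2 B, 0 <= B & forall n j, cabs (p n)`_j * R0 ^+ j <= B.
  pose S := \sum_(j < size (p 0%N)) cabs (p 0%N)`_j * R0 ^+ j.
  have S0 : 0 <= S by rewrite sumr_ge0// => j _; rewrite mulr_ge0 ?cabs_ge0 ?ltW.
  have base j : cabs (p 0%N)`_j * R0 ^+ j <= S.
    have [jp|pj] := ltnP j (size (p 0%N)); last by rewrite nth_default// cabs0 mul0r.
    rewrite /S (bigD1 (Ordinal jp)) //= lerDl sumr_ge0// => i _.
    by rewrite mulr_ge0 ?cabs_ge0 ?ltW.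
  have step n j : cabs (p n)`_j * R0 ^+ j <= S + K * \sum_(i < n) q ^+ i.
    elim: n => [|n IH]; first by rewrite big_ord0 mulr0 addr0.
    rewrite big_ord_recr /= mulrDr addrA.
    apply: le_trans (lerD IH (hp n j)).
    rewrite -mulrDl ler_wpM2r//; first exact: ltW.
    by rewrite addrC -lerBlDr cabs_rev.
  exists (S + K / (1 - q)); first by rewrite addr_ge0// divr_ge0// ltW.
  move=> n j; apply: le_trans (step n j) _.
  by rewrite lerD2l ler_wpM2l// geometric_sum_le.
exists rho, g; split => //; last by move=> z /ltW; exact: cvg.
move=> z zr.
have zr' := ltW zr.
have [D hD] := conv _ (derv z zr').
apply: (@derivable_quadratic g z D (B * L) (rho - cabs z)); first by rewrite subr_gt0.
move=> t tr.
have ztr : cabs (z + t) <= rho.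
  by rewrite (le_trans (cabsD _ _))// -lerBrDl.
apply/ler_addgt0Pr => e e0.
have ct : 0 < 1 + cabs t by rewrite ltr_pwDl ?cabs_ge0.
(* The two values and the derivative of [p N] are each off by at most [d], at a total cost of
   [(2 + |t|) d]. *)
have [|N hN] := small (2 * (K * L) / (1 - q)) (e / (2 + cabs t)) _ KL0.
  by rewrite divr_gt0// ltr_pwDl ?cabs_ge0.
have hN' := hN N (leqnn N).
set d := (2 * (K * L) / (1 - q) * q ^+ N) in hN'.
have e1 : cabs (g (z + t) - (p N).[z + t]) <= d by exact: hg.
have e2 : cabs (g z - (p N).[z]) <= d by exact: hg.
set pd := \sum_(j < size (p N)) (p N)`_j * (z ^+ j.-1 *+ j).
have e3 : cabs (D - pd) <= d by exact: hD.
have e4 : cabs ((p N).[z + t] - (p N).[z] - t * pd) <= B * L * cabs t ^+ 2.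
  have [->|t0] := eqVneq t 0.
    by rewrite addr0 subrr mul0r subrr cabs0 mulr_ge0// mulr_ge0// ltW.
  have t2 : 0 < cabs t ^+ 2 by rewrite exprn_gt0// cabs_gt0.
  (* After division by [t ^ 2] the remainders of the monomials meet the growth condition of
     [dom]. *)
  rewrite -ler_pdivrMr// -cabsX -cabsV -cabsM.
  have -> : ((p N).[z + t] - (p N).[z] - t * pd) / t ^+ 2 = \sum_(j < size (p N))
      (p N)`_j * (((z + t) ^+ j - z ^+ j - t * (z ^+ j.-1 *+ j)) / t ^+ 2).
    rewrite !hE /pd mulr_sumr -!sumrB mulr_suml; apply: eq_bigr => j _; ring.
  apply: (dom (p N) (fun j => ((z + t) ^+ j - z ^+ j - t * (z ^+ j.-1 *+ j)) / t ^+ 2))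
    => // j.
  rewrite cabsM cabsV cabsX ler_pdivrMr//.
  apply: le_trans (expr_taylor2 j (ltW rho1) zr' ztr) _.
  rewrite ler_wpM2r ?(ltW t2)// ler_wpM2r ?exprn_ge0 ?(ltW rho0)//.
  by rewrite lerXn2r ?nnegrE// ler_nat.
have -> : g (z + t) - g z - t * D = ((p N).[z + t] - (p N).[z] - t * pd) +
   ((g (z + t) - (p N).[z + t]) - (g z - (p N).[z]) - t * (D - pd)) by ring.
apply: le_trans (cabsD _ _) _; rewrite lerD//.
apply: (@le_trans _ _ (d + d + cabs t * d)).
  apply: le_trans (cabsD _ _) _; rewrite cabsN cabsM lerD//.
    by apply: le_trans (cabsD _ _) _; rewrite cabsN lerD.
  by rewrite ler_wpM2l ?cabs_ge0.
have -> : d + d + cabs t * d = (2 + cabs t) * d by ring.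
by rewrite mulrC -ler_pdivlMr// ltr_pwDl ?cabs_ge0.
Qed.

End PolynomialLimits.

(** * Weighted square-summable sequences *)

Section WeightedSquareSummable.
Context {R : realType}.
Notation C := (cplx R).
Variable omega : nat -> R.
Hypothesis omega_pos : forall n, 0 < omega n.
Implicit Types u v w : nat -> C.

Let omega_ge0 n : 0 <= omega n := ltW (omega_pos n).

Definition l2 u := exists M, forall n, \sum_(k < n) cabs (u k) ^+ 2 * omega k <= M.

(** Only the real part of the inner product is kept: it is all that Pythagoras' theorem involves,
    and minimality need then be tested with real multiples only. *)
Definition rdot_term u v k : R := cRe (u k * (v k)^*) * omega k.

Definition rdot u v : R := limn (series (rdot_term u v)).

Definition nsq u : R := rdot u u.

Lemma rdot_termxx u k : rdot_term u u k = cabs (u k) ^+ 2 * omega k.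
Proof. by rewrite /rdot_term mulrJ. Qed.

Lemma rdot_termxx_ge0 u k : 0 <= rdot_term u u k.
Proof. by rewrite rdot_termxx mulr_ge0 ?exprn_ge0 ?cabs_ge0// ltW. Qed.

Lemma nsq_series u n :
  series (rdot_term u u) n = \sum_(k < n) cabs (u k) ^+ 2 * omega k.
Proof.
by rewrite /series /= big_mkord; apply: eq_bigr => k _; rewrite rdot_termxx.
Qed.

Lemma l2_cvg u : l2 u -> cvgn (series (rdot_term u u)).
Proof.
move=> [M hM]; apply: nondecreasing_is_cvgn.
  exact: (nondecreasing_series (fun k _ _ => rdot_termxx_ge0 u k)).
exists M => _ [n _ <-]; by rewrite nsq_series.
Qed.

Lemma nsq_ge u : l2 u -> forall n, \sum_(k < n) cabs (u k) ^+ 2 * omega k <= nsq u.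
Proof.
move=> lu n; have nd := nondecreasing_series (fun k _ _ => rdot_termxx_ge0 u k).
rewrite -nsq_series; exact: nondecreasing_cvgn_le (nd xpredT 0%N) (l2_cvg lu) n.
Qed.

Lemma nsq_ge0 u : l2 u -> 0 <= nsq u.
Proof. by move=> /nsq_ge/(_ 0%N); rewrite big_ord0. Qed.

Lemma nsq_term u : l2 u -> forall n, cabs (u n) ^+ 2 * omega n <= nsq u.
Proof.
move=> lu n; apply: le_trans (nsq_ge lu n.+1); rewrite big_ord_recr /= lerDr.
by rewrite sumr_ge0// => k _; rewrite mulr_ge0 ?exprn_ge0 ?cabs_ge0// ltW.
Qed.

Lemma nsq_le u M : (forall n, \sum_(k < n) cabs (u k) ^+ 2 * omega k <= M) ->
  nsq u <= M.
Proof.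
move=> hM; have lu : l2 u by exists M.
apply: limr_le; first exact: l2_cvg.
by near=> n; rewrite nsq_series.
Unshelve. all: by end_near.
Qed.

Lemma rdot_term_le u v k :
  `|rdot_term u v k| <= rdot_term u u k + rdot_term v v k.
Proof.
rewrite !rdot_termxx /rdot_term -mulrDl normrM [`|omega k|]gtr0_norm// ler_wpM2r ?omega_ge0//.
apply: le_trans (cRe_le _) _; rewrite cabsM cabsJ.
have := sqr_ge0 (cabs (u k) - cabs (v k)); rewrite sqrrB.
have := mulr_ge0 (cabs_ge0 (u k)) (cabs_ge0 (v k)).
by rewrite mulr2n; lra.
Qed.

Lemma rdot_cvg u v : l2 u -> l2 v ->
  series (rdot_term u v) n @[n --> \oo] --> rdot u v.
Proof.
move=> lu lv; apply: normed_cvg.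
apply: (@series_le_cvg _ _ (fun k => rdot_term u u k + rdot_term v v k)).
- by move=> k; exact: normr_ge0.
- by move=> k; rewrite addr_ge0 ?rdot_termxx_ge0.
- by move=> k; exact: rdot_term_le.
have -> : series (fun k => rdot_term u u k + rdot_term v v k) =
    series (rdot_term u u) + series (rdot_term v v).
  by apply/funext => n; rewrite /series /= big_split.
by apply: is_cvgD; exact: l2_cvg.
Qed.

Lemma rdot_unique u v l : series (rdot_term u v) n @[n --> \oo] --> l -> rdot u v = l.
Proof. exact: cvg_lim. Qed.

Lemma rdotC u v : rdot u v = rdot v u.
Proof.
congr (limn (series _)); apply/funext => k; rewrite /rdot_term; congr (_ * _).
by case: (u k) => a b; case: (v k) => c d; rewrite /cRe /= !mulrN !opprK; ring.
Qed.

Lemma l2D u v : l2 u -> l2 v -> l2 (fun k => u k + v k).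
Proof.
move=> lu lv; exists (2 * nsq u + 2 * nsq v) => n.
apply: (@le_trans _ _ (2 * (\sum_(k < n) cabs (u k) ^+ 2 * omega k) +
    2 * (\sum_(k < n) cabs (v k) ^+ 2 * omega k))); last first.
  by rewrite lerD// ler_pM2l// nsq_ge.
rewrite !mulr_sumr -big_split /=; apply: ler_sum => k _.
rewrite !mulrA -mulrDl ler_wpM2r ?omega_ge0//.
apply: (@le_trans _ _ ((cabs (u k) + cabs (v k)) ^+ 2)).
  by rewrite lerXn2r ?nnegrE ?addr_ge0 ?cabs_ge0// cabsD.
by have := sqr_ge0 (cabs (u k) - cabs (v k)); rewrite sqrrB sqrrD !mulr2n; lra.
Qed.

Lemma l2Z c u : l2 u -> l2 (fun k => c * u k).
Proof.
move=> lu; exists (cabs c ^+ 2 * nsq u) => n.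
apply: le_trans (ler_wpM2l _ (nsq_ge lu n)); last by rewrite exprn_ge0 ?cabs_ge0.
rewrite mulr_sumr; apply: ler_sum => k _; by rewrite cabsM exprMn [leRHS]mulrA.
Qed.

Lemma l2B u v : l2 u -> l2 v -> l2 (fun k => u k - v k).
Proof.
move=> lu lv.
have -> : (fun k => u k - v k) = (fun k => u k + -1 * v k).
  by apply/funext => k; rewrite mulN1r.
exact: l2D lu (l2Z _ lv).
Qed.

Lemma rdotD u v w : l2 u -> l2 v -> l2 w ->
  rdot (fun k => u k + v k) w = rdot u w + rdot v w.
Proof.
move=> lu lv lw; apply: rdot_unique.
have -> : series (rdot_term (fun k => u k + v k) w) =
    series (rdot_term u w) + series (rdot_term v w).
  apply/funext => n.
  transitivity (series (rdot_term u w) n + series (rdot_term v w) n) => //.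
  rewrite /series /= -big_split /=; apply: eq_bigr => k _.
  rewrite /rdot_term [(u k + v k) * _]mulrDl.
  by case: (u k * _) => a b; case: (v k * _) => c d; rewrite /cRe /= mulrDl.
by apply: cvgD; exact: rdot_cvg.
Qed.

Lemma rdotZ (t : R) u w : l2 u -> l2 w ->
  rdot (fun k => ofreal t * u k) w = t * rdot u w.
Proof.
move=> lu lw; apply: rdot_unique.
have -> : series (rdot_term (fun k => ofreal t * u k) w) =
    (fun n => t * series (rdot_term u w) n).
  apply/funext => n; rewrite /series /= mulr_sumr; apply: eq_bigr => k _.
  rewrite /rdot_term mulrA -mulrA; congr (_ * _).
  by case: (u k) => a b; case: (w k) => c d; rewrite /cRe /ofreal /=; ring.
by apply: cvgMr; exact: rdot_cvg.
Qed.

Lemma rdotB u v w : l2 u -> l2 v -> l2 w ->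
  rdot (fun k => u k - v k) w = rdot u w - rdot v w.
Proof.
move=> lu lv lw.
have -> : (fun k => u k - v k) = (fun k => u k + ofreal (-1) * v k).
  by apply/funext => k; rewrite rmorphN1 mulN1r.
by rewrite rdotD// ?rdotZ ?mulN1r//; exact: l2Z.
Qed.

Lemma nsqD u v : l2 u -> l2 v ->
  nsq (fun k => u k + v k) = nsq u + nsq v + 2 * rdot u v.
Proof.
move=> lu lv; have luv := l2D lu lv.
rewrite /nsq rdotD// (rdotC u (fun k => _)) (rdotC v (fun k => _)).
by rewrite !rdotD// (rdotC v u); ring.
Qed.

Lemma nsqB u v : l2 u -> l2 v ->
  nsq (fun k => u k - v k) = nsq u + nsq v - 2 * rdot u v.
Proof.
move=> lu lv; have luv := l2B lu lv.
rewrite /nsq rdotB// (rdotC u (fun k => _)) (rdotC v (fun k => _)).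
by rewrite !rdotB// (rdotC v u); ring.
Qed.

Lemma nsqZ c u : l2 u -> nsq (fun k => c * u k) = cabs c ^+ 2 * nsq u.
Proof.
move=> lu; apply: rdot_unique.
have -> : series (rdot_term (fun k => c * u k) (fun k => c * u k)) =
    (fun n => cabs c ^+ 2 * series (rdot_term u u) n).
  apply/funext => n; rewrite /series /= mulr_sumr; apply: eq_bigr => k _.
  by rewrite !rdot_termxx cabsM exprMn [RHS]mulrA.
by apply: cvgMr; exact: rdot_cvg.
Qed.

Lemma nsq_eq0 u : l2 u -> nsq u = 0 -> forall k, u k = 0.
Proof.
move=> lu u0 k; have := nsq_term lu k; rewrite u0 => h; apply/eqP.
rewrite -cabs_eq0 -sqrf_eq0 -(mulIr_eq0 _ (mulIf (lt0r_neq0 (omega_pos k)))).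
by rewrite eq_le h mulr_ge0 ?exprn_ge0 ?cabs_ge0// ltW.
Qed.

Lemma nsq_min_orth u v : l2 u -> l2 v ->
  (forall t : R, nsq u <= nsq (fun k => u k + ofreal t * v k)) -> rdot u v = 0.
Proof.
move=> lu lv umin; have c0 := nsq_ge0 lv.
set b := rdot u v; set c := nsq v in c0.
(* The minimising [t] is [- b / c]; the denominator [1 + c] also covers [c = 0], and the change of
   norm is still negative unless [b = 0]. *)
have := umin (- b / (1 + c)).
have tE t : nsq (fun k => u k + ofreal t * v k) = nsq u + (t ^+ 2 * c + 2 * (t * b)).
  rewrite nsqD//; last exact: l2Z.
  by rewrite nsqZ// cabs_ofreal real_normK ?num_real// (rdotC u) rdotZ// (rdotC v u) addrA.
rewrite tE lerDl.
have c1 : 0 < 1 + c by rewrite ltr_pwDl.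
have -> : (- b / (1 + c)) ^+ 2 * c + 2 * (- b / (1 + c) * b) =
  - (b ^+ 2 * ((2 + c) / (1 + c) ^+ 2)) by field; rewrite lt0r_neq0.
rewrite oppr_ge0 => h; apply/eqP; rewrite -sqrf_eq0 eq_le sqr_ge0 andbT.
by move: h; rewrite pmulr_lle0// divr_gt0 ?exprn_gt0// ltr_pwDl.
Qed.

End WeightedSquareSummable.

(** * Coefficient sequences of products and of power series *)

Section CoefficientSequences.
Context {R : realType}.
Notation C := (cplx R).
Implicit Types (u v a : nat -> C) (p q : {poly C}).

Definition shiftn n u k : C := if (k < n)%N then 0 else u (k - n)%N.

Definition conv p a n : C := \sum_(i < n.+1) p`_i * a (n - i)%N.

Lemma convD p q a k : conv (p + q) a k = conv p a k + conv q a k.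
Proof. by rewrite /conv -big_split; apply: eq_bigr => i _; rewrite coefD mulrDl. Qed.

Lemma convZ c p a k : conv (c *: p) a k = c * conv p a k.
Proof. by rewrite /conv mulr_sumr; apply: eq_bigr => i _; rewrite coefZ mulrA. Qed.

Lemma convB p q a k : conv (p - q) a k = conv p a k - conv q a k.
Proof. by rewrite -scaleN1r convD convZ mulN1r. Qed.

Lemma convXn n a k : conv 'X^n a k = shiftn n a k.
Proof.
rewrite /conv /shiftn; case: ltnP => [kn|nk].
  by rewrite big1// => i _; rewrite coefXn ltn_eqF ?mul0r// (leq_trans (ltn_ord i)).
rewrite -ltnS in nk; rewrite (bigD1 (Ordinal nk)) //= coefXn eqxx mul1r big1 ?addr0//.
by move=> i neq; rewrite coefXn (_ : (i == n :> nat) = false) ?mul0r//; exact/negbTE.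
Qed.

Lemma convC c a k : conv c%:P a k = c * a k.
Proof.
rewrite /conv big_ord_recl coefC /= subn0 big1 ?addr0// => i _.
by rewrite coefC /= mul0r.
Qed.

Lemma convMX p a k : conv (p * 'X) a k = shiftn 1 (conv p a) k.
Proof.
rewrite /shiftn /conv; case: k => [|k] /=; first by rewrite big_ord1 coefMX mul0r.
rewrite big_ord_recl coefMX mul0r add0r subn1 /=; apply: eq_bigr => i _.
by rewrite coefMX /= /bump /= add1n.
Qed.

Lemma convMXC p c a k : conv (p * 'X + c%:P) a k = shiftn 1 (conv p a) k + c * a k.
Proof. by rewrite convD convC convMX. Qed.

Lemma power_seriesD a b (g h : C -> C) : power_series a g -> power_series b h ->
  power_series (fun k => a k + b k) (fun z => g z + h z).
Proof.
move=> ag bh z z1; rewrite (_ : series _ =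
    series (fun k => a k * z ^+ k) + series (fun k => b k * z ^+ k)).
  by apply: cvgD; [exact: ag|exact: bh].
apply/funext => n; transitivity (series (fun k => a k * z ^+ k) n +
  series (fun k => b k * z ^+ k) n) => //.
by rewrite /series /= -big_split; apply: eq_bigr => k _; rewrite mulrDl.
Qed.

Lemma power_seriesZ c a (g : C -> C) : power_series a g ->
  power_series (fun k => c * a k) (fun z => c * g z).
Proof.
move=> ag z z1; rewrite (_ : series _ = (fun n => c * series (fun k => a k * z ^+ k) n)).
  by apply: cvgMr; exact: ag.
by apply/funext => n; rewrite /series /= mulr_sumr; apply: eq_bigr => k _; rewrite mulrA.
Qed.

Lemma power_seriesB a b (g h : C -> C) : power_series a g -> power_series b h ->
  power_series (fun k => a k - b k) (fun z => g z - h z).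
Proof.
move=> ag bh; have := power_seriesD ag (@power_seriesZ (-1) _ _ bh).
have -> : (fun k => a k + -1 * b k) = (fun k => a k - b k).
  by apply/funext => k; rewrite mulN1r.
by have -> : (fun z => g z + -1 * h z) = (fun z => g z - h z)
  by apply/funext => z; rewrite mulN1r.
Qed.

Lemma power_series_shift a (g : C -> C) : power_series a g ->
  power_series (shiftn 1 a) (fun z => z * g z).
Proof.
move=> ag z z1; rewrite -cvg_shiftS.
rewrite (_ : (fun n => _) = (fun n => z * series (fun k => a k * z ^+ k) n)).
  by apply: cvgMr; exact: ag.
apply/funext => n; rewrite /series /= big_nat_recl// /shiftn mul0r add0r mulr_sumr.
by apply: eq_bigr => k _; rewrite /= subn1 exprS mulrCA.
Qed.

Definition delta0 k : C := if k is 0 then 1 else 0.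

Lemma power_series1 : power_series delta0 (fun=> 1).
Proof.
move=> z z1; rewrite -cvg_shiftS; rewrite (_ : (fun n => _) = (fun=> 1)); first exact: cvg_cst.
apply/funext => n; rewrite /series /= big_nat_recl// mul1r expr0 big1 ?addr0// => k _.
by rewrite mul0r.
Qed.

Lemma power_series_conv p a (f : C -> C) : power_series a f ->
  power_series (conv p a) (pmul p f).
Proof.
move=> af; elim/poly_ind: p => [|p c IH].
  have -> : pmul 0 f = (fun z => 0 * f z) by apply/funext => z; rewrite /pmul horner0.
  have -> : conv 0 a = (fun k => 0 * a k).
    by apply/funext => k; rewrite -(convC 0 a k) polyC0.
  exact: power_seriesZ.
have -> : pmul (p * 'X + c%:P) f = (fun z => z * pmul p f z + c * f z).
  by apply/funext => z; rewrite /pmul hornerMXaddC mulrDl [_ * z]mulrC mulrA.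
have -> : conv (p * 'X + c%:P) a = (fun k => shiftn 1 (conv p a) k + c * a k).
  by apply/funext => k; rewrite convMXC.
by apply: power_seriesD; [exact: power_series_shift|exact: power_seriesZ].
Qed.

Lemma power_series_at0 a (h : C -> C) : power_series a h -> h 0 = a 0%N.
Proof.
move=> ah; have z1 : cabs (0 : C) < 1 by rewrite cabs0.
apply/eqP; rewrite -subr_eq0 -cabs_eq0 eq_le cabs_ge0 andbT.
apply/ler_addgt0Pr => e e0; rewrite add0r.
have [N hN] := power_series_cvg ah z1 e0.
have := hN N.+1 (leqnSn N); rewrite psumE big_ord_recl expr0 mulr1 big1 ?addr0//.
by move=> i _; rewrite exprS mul0r mulr0.
Qed.

(** The difference represents 0, so its partial sums are uniformly small on the circle of radius
    1/2, and Cauchy's inequalities make each coefficient small. *)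
Lemma power_series_unique a b (h : C -> C) : power_series a h -> power_series b h -> a = b.
Proof.
move=> ah bh; have := power_seriesB ah bh.
set c := fun k => _ => ch; apply/funext => j; apply/eqP; rewrite -subr_eq0 -/(c j).
rewrite -cabs_eq0 eq_le cabs_ge0 andbT.
have h2 : (1 / 2 : R) < 1 by lra.
have h20 : 0 < (1 / 2 : R) by lra.
have pw : 0 < (1 / 2 : R) ^+ j by rewrite exprn_gt0.
rewrite -(ler_pM2r pw) mul0r; apply/ler_addgt0Pr => e e0; rewrite add0r.
have [N hN] := power_series_uniform ch h2 e0.
have -> : c j = (psum c (maxn N j.+1))`_j.
  by rewrite coef_poly (leq_trans _ (leq_maxr _ _)).
apply: cauchy_estimate => [|z zr]; first exact: ltW.
have := hN (maxn N j.+1) z (leq_maxl _ _); rewrite zr lexx => /(_ isT).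
by rewrite subrr sub0r cabsN.
Qed.

Lemma coefsE a (h : C -> C) : power_series a h -> coefs h = a.
Proof.
move=> ah; rewrite /coefs; case: xgetP => [b _ bh|/(_ a)//].
exact: power_series_unique bh ah.
Qed.

End CoefficientSequences.

(** * Subexponential weights and point evaluations *)

Section WeightedSpace.
Context {R : realType}.
Notation C := (cplx R).
Variable omega : nat -> R.
Hypothesis omega_pos : forall n, 0 < omega n.
Hypothesis omega_lim : omega n / omega n.+1 @[n --> \oo] --> (1 : R).
Implicit Types (u v a : nat -> C) (p q : {poly C}).

Let omega_ge0 n : 0 <= omega n := ltW (omega_pos n).

Lemma h2sqnormE u (h : C -> C) : power_series u h -> l2 omega u ->
  h2sqnorm omega h = (nsq omega u)%:E.
Proof.
move=> uh lu; rewrite /h2sqnorm (coefsE uh) -EFin_lim; last exact: l2_cvg.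
congr (limn _); apply/funext => n /=; rewrite /series /= -sumEFin.
by apply: eq_bigr => k _; rewrite rdot_termxx.
Qed.

Lemma h2sqnorm_l2 u (h : C -> C) : power_series u h -> (h2sqnorm omega h < +oo)%E ->
  l2 omega u.
Proof.
move=> uh; rewrite /h2sqnorm (coefsE uh); set S := (X in (X < _)%E) => Sfin.
have term_ge0 n : (0 <= (cabs (u n) ^+ 2 * omega n)%:E)%E.
  by rewrite lee_fin mulr_ge0 ?exprn_ge0 ?cabs_ge0.
have Sge n : ((\sum_(k < n) cabs (u k) ^+ 2 * omega k)%:E <= S)%E.
  rewrite -(big_mkord xpredT (fun k => cabs (u k) ^+ 2 * omega k)) -sumEFin.
  by apply: nneseries_lim_ge => k _ _; exact: term_ge0.
have Sf : S \is a fin_num.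
  rewrite fin_numElt Sfin andbT (lt_le_trans _ (Sge 0%N))// big_ord0.
  exact: ltNyr.
by exists (fine S) => n; rewrite -lee_fin fineK.
Qed.

Lemma weight_ratio e : 0 < e -> exists N, forall n, (N <= n)%N ->
  omega n.+1 <= (1 + e) * omega n /\ omega n <= (1 + e) * omega n.+1.
Proof.
(* Then [(1 - d) (1 + e) = 1] and [d <= e], so one estimate of the ratio controls both
   directions. *)
move=> e0; pose d := e / (1 + e).
have e1 : 0 < 1 + e by rewrite addr_gt0.
have d0 : 0 < d by rewrite divr_gt0.
have dE : (1 - d) * (1 + e) = 1 by rewrite /d; field; rewrite lt0r_neq0.
have de : d <= e by rewrite ler_pdivrMr// ler_peMr// ?ltW//; lra.
have /cvgrPdist_le/(_ d d0)[N _ hN] := omega_lim.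
exists N => n /hN; rewrite ler_distl => /andP[h1 h2].
have w1 := omega_pos n.+1.
have := ler_pM2r w1 (1 - d) (omega n / omega n.+1).
have := ler_pM2r w1 (omega n / omega n.+1) (1 + d).
rewrite divfK ?lt0r_neq0// => E2 E1; split; last first.
  have : omega n / omega n.+1 <= 1 + d by lra.
  rewrite -E2 => /le_trans; apply; rewrite ler_pM2r//; lra.
have : 1 - d <= omega n / omega n.+1 by lra.
rewrite -E1 -(ler_pM2r e1) mulrAC dE mul1r => /le_trans; apply.
by rewrite mulrC.
Qed.

(** Applied to [omega] and to its inverse. At most [N] steps are not controlled by [1 + e], and each
    of these costs a factor [A], whatever the starting index [k]. *)
Lemma weight_growth (w : nat -> R) e : (forall n, 0 < w n) -> 0 < e ->
  (exists N, forall n, (N <= n)%N -> w n.+1 <= (1 + e) * w n) ->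
  exists2 K, 0 < K & forall n k, w (k + n)%N <= K * (1 + e) ^+ n * w k.
Proof.
move=> w0 e0 [N hN]; have e1 : 1 <= 1 + e by rewrite lerDl ltW.
pose A := 1 + \sum_(k < N) w k.+1 / w k.
have r0 k : 0 <= w k.+1 / w k by rewrite divr_ge0// ltW.
have A1 : 1 <= A by rewrite lerDl sumr_ge0.
have Ak k : (k < N)%N -> w k.+1 <= A * w k.
  move=> kN; rewrite -ler_pdivrMr// /A (bigD1 (Ordinal kN)) //= addrCA lerDl.
  by rewrite addr_ge0 ?sumr_ge0.
have A0 : 0 < A by apply: lt_le_trans A1.
have claim n k : w (k + n)%N <= A ^+ (N - k) * (1 + e) ^+ n * w k.
  elim: n k => [|n IH] k.
    by rewrite addn0 expr0 mulr1 ler_peMl ?exprn_ege1// ltW.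
  rewrite addnS -addSn; apply: le_trans (IH k.+1) _.
  have en0 : 0 <= (1 + e) ^+ n by rewrite exprn_ge0 // (le_trans _ e1).
  have [Nk|kN] := leqP N k.
    have -> : (N - k.+1 = N - k)%N by lia.
    rewrite exprSr -!mulrA ler_wpM2l ?exprn_ge0 ?(ltW A0)// ler_wpM2l//.
    exact: hN.
  have -> : (N - k = (N - k.+1).+1)%N by lia.
  rewrite exprSr -!mulrA ler_wpM2l ?exprn_ge0 ?(ltW A0)//.
  rewrite [leRHS](_ : _ = (1 + e) ^+ n.+1 * (A * w k)); last by ring.
  by rewrite ler_pM ?(ltW (w0 _)) ?Ak// ler_weXn2l.
exists (A ^+ N); first by rewrite exprn_gt0.
move=> n k; apply: le_trans (claim n k) _.
rewrite ler_wpM2r ?(ltW (w0 _))// ler_wpM2r//; first by rewrite exprn_ge0 // (le_trans _ e1).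
by rewrite ler_weXn2l// leq_subr.
Qed.

Lemma omega_growth e : 0 < e ->
  exists2 K, 0 < K & forall n k, omega (k + n)%N <= K * (1 + e) ^+ n * omega k.
Proof.
move=> e0; apply: weight_growth => //.
by have [N hN] := weight_ratio e0; exists N => n /hN[].
Qed.

Lemma omega_inv_growth e : 0 < e ->
  exists2 K, 0 < K & forall k, (omega k)^-1 <= K * (1 + e) ^+ k.
Proof.
move=> e0; have [||K K0 hK] := @weight_growth (fun n => (omega n)^-1) e _ e0.
- by move=> n; rewrite invr_gt0.
- have [N hN] := weight_ratio e0; exists N => n /hN[_ h].
  by rewrite ler_pdivlMr// mulrC ler_pdivrMr.
exists (K / omega 0%N); first by rewrite divr_gt0.
by move=> k; have := hK k 0%N; rewrite add0n mulrAC.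
Qed.

Lemma shiftn_sum_le n u G : (forall k, omega (k + n)%N <= G * omega k) -> l2 omega u ->
  forall N, \sum_(k < N) cabs (shiftn n u k) ^+ 2 * omega k <= G * nsq omega u.
Proof.
move=> hG lu N.
have G0 : 0 <= G.
  by have := hG 0%N; rewrite -ler_pdivrMr//; apply: le_trans; rewrite divr_ge0.
have term_ge0 k : 0 <= cabs (shiftn n u k) ^+ 2 * omega k.
  by rewrite mulr_ge0 ?exprn_ge0 ?cabs_ge0.
apply: (@le_trans _ _ (\sum_(k < n + N) cabs (shiftn n u k) ^+ 2 * omega k)).
  by rewrite addnC big_split_ord /= lerDl sumr_ge0.
rewrite big_split_ord /= big1 ?add0r => [|i _]; last first.
  by rewrite /shiftn ltn_ord cabs0 expr0n mul0r.
apply: le_trans (ler_wpM2l G0 (nsq_ge omega_pos lu N)); rewrite mulr_sumr.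
apply: ler_sum => i _; rewrite /shiftn ltnNge leq_addr addKn mulrCA.
by rewrite ler_wpM2l ?exprn_ge0 ?cabs_ge0// addnC.
Qed.

Lemma l2_shiftn n u : l2 omega u -> l2 omega (shiftn n u).
Proof.
move=> lu; have [K K0 hK] := omega_growth ltr01.
by exists (K * (1 + 1) ^+ n * nsq omega u); exact: shiftn_sum_le.
Qed.

Lemma nsq_shiftn e u : 0 < e -> l2 omega u ->
  exists2 K, 0 < K & forall n, nsq omega (shiftn n u) <= K * (1 + e) ^+ n.
Proof.
move=> e0 lu; have [K K0 hK] := omega_growth e0.
have nu := nsq_ge0 omega_pos lu.
exists (K * (1 + nsq omega u)); first by rewrite mulr_gt0// ltr_pwDl.
move=> n; apply: nsq_le => // N; apply: le_trans (shiftn_sum_le _ lu N) _ => //.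
rewrite mulrAC; apply: ler_wpM2r; first by rewrite exprn_ge0// addr_ge0// ltW.
by rewrite ler_wpM2l ?(ltW K0)// lerDr.
Qed.

Lemma l2_conv p a : l2 omega a -> l2 omega (conv p a).
Proof.
move=> la; elim/poly_ind: p => [|p c IH].
  have -> : conv 0 a = (fun k => 0 * a k).
    by apply/funext => k; rewrite -(convC 0 a k) polyC0.
  exact: l2Z.
have -> : conv (p * 'X + c%:P) a = (fun k => shiftn 1 (conv p a) k + c * a k).
  by apply/funext => k; rewrite convMXC.
by apply: l2D => //; [exact: l2_shiftn|exact: l2Z].
Qed.

Lemma l2_delta0 : l2 omega delta0.
Proof.
exists (omega 0%N) => -[|n]; first by rewrite big_ord0.
rewrite -(big_mkord xpredT (fun k => cabs (delta0 k) ^+ 2 * omega k)) big_nat_recl//.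
rewrite (_ : delta0 0%N = 1)// cabs1 expr1n mul1r big1 ?addr0// => i _.
by rewrite (_ : delta0 i.+1 = 0)// cabs0 expr0n mul0r.
Qed.

Lemma rdot_delta0 u : rdot omega delta0 u = cRe (u 0%N) * omega 0%N.
Proof.
apply: rdot_unique; rewrite -cvg_shiftS.
rewrite (_ : (fun n => _) = (fun=> cRe (u 0%N) * omega 0%N)); first exact: cvg_cst.
apply/funext => n; rewrite /series /= big_nat_recl// big1 ?addr0 => [|i _].
  by rewrite /rdot_term /= mul1r; case: (u 0%N).
by rewrite /rdot_term /= mul0r /cRe /= mul0r.
Qed.

(** A single coefficient satisfies [|u k| ^ 2 <= M ^ 2 / omega k], and [1 / omega k] is
    subexponential; choosing [r ^ 2 (1 + e) = x ^ 2] with [x < 1] leaves a geometric series. *)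
Lemma point_evaluation_bound r : 0 < r -> r < 1 -> exists2 K, 0 < K &
  forall u (h : C -> C) M, power_series u h -> l2 omega u -> 0 <= M ->
    nsq omega u <= M ^+ 2 -> forall z, cabs z <= r -> cabs (h z) <= K * M.
Proof.
move=> r0 r1; have [x [x0 x1 rx]] : exists x, [/\ 0 < x, x < 1 & r < x].
  by exists ((1 + r) / 2); split; lra.
have rr : 0 < r ^+ 2 by rewrite exprn_gt0.
have [e e0 he] : exists2 e, 0 < e & r ^+ 2 * (1 + e) = x ^+ 2.
  exists (x ^+ 2 / r ^+ 2 - 1); last by field; rewrite lt0r_neq0.
  by rewrite subr_gt0 ltr_pdivlMr// mul1r ltrXn2r// ?ltW.
have [K K0 hK] := omega_inv_growth e0.
have K1 : 1 <= 1 + K by rewrite lerDl ltW.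
have x1' : 0 < 1 - x by rewrite subr_gt0.
exists ((1 + K) / (1 - x)); first by rewrite divr_gt0// addr_gt0.
move=> u h M uh lu M0 hM z zr; have K10 : 0 <= 1 + K by apply: le_trans K1.
have term k : cabs (u k * z ^+ k) <= (1 + K) * M * x ^+ k.
  rewrite -(@ler_pXn2r _ 2)// ?nnegrE ?cabs_ge0//; last first.
    by rewrite !mulr_ge0 ?exprn_ge0// ltW.
  rewrite cabsM cabsX !exprMn.
  apply: (@le_trans _ _ ((M ^+ 2 * (omega k)^-1) * (r ^+ 2) ^+ k)).
    apply: ler_pM; rewrite ?sqr_ge0//.
      by rewrite ler_pdivlMr// (le_trans _ hM)//; exact: nsq_term.
    rewrite [leLHS]exprAC lerXn2r ?nnegrE ?sqr_ge0// lerXn2r ?nnegrE ?cabs_ge0//.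
    exact: ltW.
  rewrite [(x ^+ k) ^+ 2]exprAC -he [(_ * (1 + e)) ^+ k]exprMn.
  apply: (@le_trans _ _ (M ^+ 2 * (K * (1 + e) ^+ k) * (r ^+ 2) ^+ k)).
    by rewrite ler_wpM2r ?exprn_ge0 ?(ltW r0)// ler_wpM2l ?exprn_ge0.
  rewrite [leLHS](_ : _ = K * (M ^+ 2 * ((r ^+ 2) ^+ k * (1 + e) ^+ k))); last by ring.
  rewrite -[leRHS]mulrA ler_wpM2r//.
    by rewrite !mulr_ge0 ?exprn_ge0// ?(ltW r0)// ltW// addr_gt0.
  by rewrite expr2; apply: le_trans (ler_peMl _ K1); rewrite ?lerDr.
apply/ler_addgt0Pr => d d0.
have [N hN] := power_series_cvg uh (le_lt_trans zr r1) d0.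
rewrite -[h z](subrK (psum u N).[z]) addrC.
apply: le_trans (cabsD _ _) _; rewrite lerD ?hN// psumE.
apply: le_trans (cabs_sum _ _ _) _.
apply: (@le_trans _ _ (\sum_(k < N) (1 + K) * M * x ^+ k)).
  by apply: ler_sum => k _; exact: term.
rewrite -mulr_sumr [leRHS]mulrAC ler_wpM2l//; first exact: mulr_ge0.
exact: geometric_sum_le (ltW x0) x1.
Qed.

End WeightedSpace.

Section RealImaginaryParts.
Context {R : realType}.
Notation C := (cplx R).

Lemma cRe_mulr (z : C) (r : R) : cRe (z * ofreal r) = cRe z * r.
Proof. by case: z => s t; rewrite /cRe /ofreal /=; ring. Qed.

Lemma cIm_mulr (z : C) (r : R) : cIm (z * ofreal r) = cIm z * r.
Proof. by case: z => s t; rewrite /cIm /ofreal /=; ring. Qed.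

(** Makes the imaginary part of an inner product a real inner product again. *)
Lemma cRe_Ni (z : C) : cRe ((Complex 0 (- 1) : C) * z) = cIm z.
Proof. by case: z => s t; rewrite /cRe /cIm /=; ring. Qed.

Lemma complex_cvg (x : nat -> C) (A B : R) : cRe (x n) @[n --> \oo] --> A ->
  cIm (x n) @[n --> \oo] --> B -> x n @[n --> \oo] --> (Complex A B : C).
Proof.
move=> /cvgrPdist_le xA /cvgrPdist_le xB; apply/cvgrPdist_le => e /posC[r r0 ->].
have r2 : 0 < r / 2 by rewrite divr_gt0.
near=> n; rewrite normE ofreal_le.
apply: le_trans (cabs_le_Re_Im _) _; rewrite cReB cImB [r]splitr lerD//.
  by near: n; exact: xA.
by near: n; exact: xB.
Unshelve. all: by end_near.
Qed.

End RealImaginaryParts.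

(** * Optimal approximants *)

Section OptimalApproximants.
Context {R : realType}.
Notation C := (cplx R).
Variable omega : nat -> R.
Hypothesis omega_pos : forall n, 0 < omega n.
Hypothesis omega0 : omega 0%N = 1.
Hypothesis omega_lim : omega n / omega n.+1 @[n --> \oo] --> (1 : R).
Variables (f : C -> C) (a : nat -> C).
Hypothesis fa : power_series a f.
Hypothesis la : l2 omega a.

Local Notation nsq := (nsq omega).
Local Notation rdot := (rdot omega).
Local Notation l2 := (l2 omega).

Let convf q := @power_series_conv R q a f fa.
Arguments convf : clear implicits.

Implicit Types (p q : {poly C}) (u v : nat -> C).

Definition residual p k : C := conv p a k - delta0 k.

Lemma l2_residual p : l2 (residual p).
Proof. by apply: l2B => //; [exact: l2_conv|exact: l2_delta0]. Qed.

Lemma h2sqnorm_residual p :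
  h2sqnorm omega (fun z => (pmul p f z - 1)%R) = (nsq (residual p))%:E.
Proof.
have rf := power_seriesB (convf p) power_series1.
exact: (h2sqnormE omega_pos rf (l2_residual p)).
Qed.

Lemma optimal_orth n p q : optimal_approximant omega f n p -> (size q <= n.+1)%N ->
  rdot (residual p) (conv q a) = 0.
Proof.
move=> [sp pmin] sq; apply: nsq_min_orth => //.
- exact: l2_residual.
- exact: l2_conv.
move=> t; have := pmin (p + ofreal t *: q); rewrite !h2sqnorm_residual lee_fin.
have -> : residual (p + ofreal t *: q) = (fun k => residual p k + ofreal t * conv q a k).
  by apply/funext => k; rewrite /residual convD convZ addrAC.
apply; rewrite (leq_trans (size_polyD _ _))// geq_max sp.
exact: leq_trans (size_scale_leq _ _) sq.
Qed.

(** The residual is orthogonal to [p f], and [1 = p f - (p f - 1)], so Pythagoras gives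
    [|p f| ^ 2 <= |1| ^ 2 = 1]. *)
Lemma nsq_optimal_le1 n p : optimal_approximant omega f n p -> nsq (conv p a) <= 1.
Proof.
move=> popt; have lp : l2 (conv p a) by exact: l2_conv.
have lr := l2_residual p; have [sp _] := popt.
have : nsq (fun k => conv p a k - residual p k) = 1.
  have -> : (fun k => conv p a k - residual p k) = delta0.
    by apply/funext => k; rewrite /residual subKr.
  by rewrite /nsq rdot_delta0// omega0 mulr1.
rewrite nsqB// rdotC (optimal_orth popt)// mulr0 subr0 => <-.
by rewrite lerDl nsq_ge0.
Qed.

(** With [q] the difference [d] without its top term, [d f] is orthogonal to [q f]. Hence the norm
    of [d f] is at most that of [d f - q f = l z ^ n.+1 f]. *)
Lemma nsq_optimal_diff_le n p p' : optimal_approximant omega f n p ->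
  optimal_approximant omega f n.+1 p' ->
  nsq (conv (p' - p) a) <= cabs p'`_n.+1 ^+ 2 * nsq (shiftn n.+1 a).
Proof.
move=> popt popt'; have [sp _] := popt; have [sp' _] := popt'.
set d := p' - p; set l := p'`_n.+1.
pose q := d - l *: 'X^(n.+1).
have sq : (size q <= n.+1)%N.
  apply/leq_sizeP => j nj; rewrite coefB coefZ coefXn coefB (nth_default _ (leq_trans sp nj)) subr0.
  move: nj; rewrite leq_eqVlt => /orP[/eqP <-|nj]; first by rewrite eqxx mulr1 subrr.
  by rewrite (gtn_eqF nj) mulr0 subr0 nth_default// (leq_trans sp').
have ld : l2 (conv d a) by exact: l2_conv.
have lq : l2 (conv q a) by exact: l2_conv.
have orth : rdot (conv d a) (conv q a) = 0.
  have -> : conv d a = (fun k => residual p' k - residual p k).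
    by apply/funext => k; rewrite /residual /d convB; ring.
  rewrite rdotB//; try exact: l2_residual.
  by rewrite (optimal_orth popt)// (optimal_orth popt') ?subrr// leqW.
have <- : nsq (fun k => conv d a k - conv q a k) = cabs l ^+ 2 * nsq (shiftn n.+1 a).
  rewrite -nsqZ//; last exact: l2_shiftn.
  congr nsq; apply/funext => k; rewrite -convXn -convZ /q convB; ring.
by rewrite nsqB// orth mulr0 subr0 lerDl nsq_ge0.
Qed.

(** [h2dot] is a bare [lim], so the real and imaginary series must both be shown to converge before
    its vanishing says anything. *)
Lemma h2dot_rdot u v (g h : C -> C) : power_series u g -> power_series v h ->
  l2 u -> l2 v -> h2dot omega g h = 0 -> rdot u v = 0.
Proof.
move=> ug vh lu lv; rewrite /h2dot (coefsE ug) (coefsE vh).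
set x := series _ => x0.
have ReE n : cRe (x n) = series (rdot_term omega u v) n.
  rewrite /x /series /= (big_morph (@cRe R) (id1 := 0) (op1 := +%R)) //; last first.
    by move=> [? ?] [? ?].
  by apply: eq_bigr => k _; rewrite cRe_mulr.
have ImE n : cIm (x n) = series (rdot_term omega (fun k => (Complex 0 (- 1) : C) * u k) v) n.
  rewrite /x /series /= (big_morph (@cIm R) (id1 := 0) (op1 := +%R)) //; last first.
    by move=> [? ?] [? ?].
  by apply: eq_bigr => k _; rewrite cIm_mulr /rdot_term -mulrA cRe_Ni.
have xl : x n @[n --> \oo] --> (Complex (rdot u v)
    (rdot (fun k => (Complex 0 (- 1) : C) * u k) v) : C).
  apply: complex_cvg; first by rewrite (funext ReE); exact: rdot_cvg.
  by rewrite (funext ImE); apply: rdot_cvg => //; exact: l2Z.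
have : lim (x n @[n --> \oo]) = Complex (rdot u v) (rdot (fun k => (Complex 0 (- 1) : C) * u k) v).
  by apply: cvg_lim xl; exact: norm_hausdorff.
by rewrite x0 => -[<-].
Qed.

Lemma closure_fP_pmul q : closure_fP omega f (pmul q f).
Proof.
have qf := convf q; have lq : l2 (conv q a) by exact: l2_conv.
split; first by split; [exists (conv q a)|rewrite (h2sqnormE omega_pos qf)// ltry].
move=> e e0; exists q; rewrite (h2sqnormE omega_pos (power_seriesB qf qf)); last exact: l2B.
rewrite lte_fin (le_lt_trans _ e0)//; apply: nsq_le => // n.
by rewrite big1// => k _; rewrite subrr cabs0 expr0n mul0r.
Qed.

Section Projection.
Variables (W : C -> C) (w : nat -> C).
Hypothesis Ww : power_series w W.
Hypothesis lw : l2 w.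
Hypothesis W_proj : is_W omega f W.

Let defect k : C := delta0 k - w k.

Let l2_defect : l2 defect.
Proof. by apply: l2B => //; exact: l2_delta0. Qed.

Lemma defect_orth v (g : C -> C) : closure_fP omega f g -> power_series v g -> l2 v ->
  rdot defect v = 0.
Proof.
move=> gcl vg lv; have [_ /(_ g gcl)] := W_proj; move=> D0.
exact: (h2dot_rdot (power_seriesB power_series1 Ww) vg l2_defect lv D0).
Qed.

(** Pythagoras for [q f - 1 = (q f - W) - (1 - W)]: minimising the distance to 1 is minimising the
    distance to [W]. *)
Lemma nsq_residualE q :
  nsq (residual q) = nsq (fun k => conv q a k - w k) + nsq defect.
Proof.
have lq : l2 (conv q a) by exact: l2_conv.
have -> : residual q = (fun k => (conv q a k - w k) - defect k).
  by apply/funext => k; rewrite /residual /defect; ring.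
rewrite nsqB//; last exact: l2B.
rewrite rdotB// ![rdot _ defect]rdotC (defect_orth (closure_fP_pmul q) (convf q))//.
by rewrite (defect_orth W_proj.1 Ww)// subrr mulr0 subr0.
Qed.

Lemma optimal_cvg_proj (p : nat -> {poly C}) :
  (forall n, optimal_approximant omega f n (p n)) ->
  forall e, 0 < e -> exists N, forall n, (N <= n)%N ->
    nsq (fun k => conv (p n) a k - w k) <= e.
Proof.
move=> popt e e0; have [[_ /(_ e e0)[q qe]] _] := W_proj; move: qe.
rewrite (h2sqnormE omega_pos (power_seriesB (convf q) Ww)); last first.
  by apply: l2B => //; exact: l2_conv.
rewrite lte_fin => qe; exists (size q) => n qn.
have [_ /(_ q (leqW qn))] := popt n.
rewrite !h2sqnorm_residual lee_fin !nsq_residualE lerD2r => /le_trans; apply.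
exact: ltW.
Qed.

(** Since [W] is orthogonal to [1 - W], its squared norm is the real part of [W 0]. If [W 0] were 0,
    then [W = 0] and 1 would be orthogonal to [f / f 0], whose inner product with 1 is 1. *)
Lemma proj_at0_neq0 : f 0 != 0 -> W 0 != 0.
Proof.
move=> f0; apply/negP => /eqP; rewrite (power_series_at0 Ww) => w0.
have ld := l2_delta0 omega_pos.
have := defect_orth W_proj.1 Ww lw; rewrite rdotB// rdot_delta0// w0 mul0r sub0r.
move=> /eqP; rewrite oppr_eq0 => /eqP /(nsq_eq0 omega_pos lw) wz.
pose q : {poly C} := (a 0%N)^-1%:P.
have lq : l2 (conv q a) by exact: l2_conv.
have := defect_orth (closure_fP_pmul q) (convf q) lq.
have -> : defect = delta0 by apply/funext => k; rewrite /defect wz subr0.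
rewrite rdot_delta0// convC mulVf -?(power_series_at0 fa)// omega0 mulr1 => /eqP.
by rewrite oner_eq0.
Qed.

End Projection.

End OptimalApproximants.

(** * Coefficient bounds and pointwise limits *)

Section Assembly.
Context {R : realType}.
Notation C := (cplx R).
Variable omega : nat -> R.
Hypothesis omega_pos : forall n, 0 < omega n.
Hypothesis omega_lim : omega n / omega n.+1 @[n --> \oo] --> (1 : R).

(** [f] may vanish in the disk, so the bound on [p f] is divided by [f] only on a circle of radius
    [s > r] free of zeros; Cauchy's inequalities on it yield the coefficients. *)
Lemma coef_bound (f : C -> C) (a : nat -> C) (r : R) :
  power_series a f -> l2 omega a -> f 0 != 0 -> 0 < r < 1 ->
  exists2 K, 0 < K & forall (p : {poly C}) M, 0 <= M ->
    nsq omega (conv p a) <= M ^+ 2 -> forall j, cabs p`_j * r ^+ j <= K * M.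
Proof.
move=> fa la f0 /andP[r0 r1].
have rm : r < (1 + r) / 2 by lra.
have m1 : (1 + r) / 2 < 1 by lra.
have [s /andP[rs sm] fs] := zero_free_circle fa f0 rm m1.
have s0 : 0 < s by apply: lt_trans rs.
have s1 : s < 1 by apply: lt_trans m1.
have [m m0 hm] := circle_lower_bound fa s0 s1 fs.
have [K K0 hK] := point_evaluation_bound omega_pos omega_lim s0 s1.
exists (K / m); first by rewrite divr_gt0.
move=> p M M0 hM j; apply: (@le_trans _ _ (cabs p`_j * s ^+ j)).
  by rewrite ler_wpM2l ?cabs_ge0// lerXn2r ?nnegrE ?(ltW r0) ?(ltW s0) ?(ltW rs).
apply: cauchy_estimate (ltW s0) _ => z zs.
have := hK _ _ M (@power_series_conv _ p _ _ fa) (l2_conv omega_pos omega_lim p la) M0 hM z.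
rewrite zs lexx cabsM => /(_ isT) H.
rewrite mulrAC ler_pdivlMr// (le_trans _ H)// ler_wpM2l ?cabs_ge0//.
exact: hm.
Qed.

(** A limit point must be approached by zeros other than [zeta], which may itself be a zero. The
    argument is therefore run at [zeta'], in a disk that avoids [zeta]. *)
Lemma nearby_circle_point (zeta : C) (d : R) : cabs zeta = 1 -> 0 < d ->
  exists2 zeta' : C, cabs zeta' = 1 & 0 < cabs (zeta' - zeta) <= d.
Proof.
(* For [u = c + i s] on the circle, [s ^ 2 <= s] gives [c >= 1 - s], whence
   [|u - 1| <= 2 s <= d]. *)
move=> z1 d0; pose s := Num.min (d / 2) (1 / 2).
have [s0 sd s1] : [/\ 0 < s, s <= d / 2 & s <= 1 / 2].
  by rewrite /s lt_min !ge_min !lexx orbT !divr_gt0.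
clearbody s.
have ss : s ^+ 2 <= s by rewrite expr2 ler_piMr ?(ltW s0)//; lra.
have ss1 : 0 <= 1 - s ^+ 2 by lra.
pose c := Num.sqrt (1 - s ^+ 2); have c0 : 0 <= c := sqrtr_ge0 _.
have cc : c ^+ 2 = 1 - s ^+ 2 by rewrite sqr_sqrtr.
have c1 : c <= 1 by rewrite -(@ler_pXn2r _ 2)// ?nnegrE// cc expr1n; have := sqr_ge0 s; lra.
have cs : 1 - s <= c.
  rewrite -(@ler_pXn2r _ 2)// ?nnegrE//; last lra.
  by rewrite cc sqrrB expr1n mul1r mulr2n; lra.
pose u : C := Complex c s.
have u1 : cabs u = 1 by rewrite /cabs /u /= cc subrK sqrtr1.
have uB : cabs (u - 1) = Num.sqrt ((c - 1) ^+ 2 + s ^+ 2).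
  by rewrite /cabs /u /= subr0.
exists (zeta * u); first by rewrite cabsM z1 u1 mul1r.
have -> : zeta * u - zeta = zeta * (u - 1) by rewrite mulrBr mulr1.
rewrite cabsM z1 mul1r; apply/andP; split.
  by rewrite uB sqrtr_gt0 ltr_wpDl ?sqr_ge0// exprn_gt0.
apply: le_trans (cabs_le_Re_Im _) _; rewrite cReB cImB /cRe /cIm /= subr0.
rewrite distrC ger0_norm ?subr_ge0// gtr0_norm//; lra.
Qed.

Lemma quotient_limit (p : nat -> {poly C}) (f W : C -> C) (a w : nat -> C) :
  power_series a f -> power_series w W -> l2 omega a -> l2 omega w ->
  (forall e, 0 < e -> exists N, forall n, (N <= n)%N ->
    nsq omega (fun k => conv (p n) a k - w k) <= e) ->
  forall z, cabs z < 1 -> forall e, 0 < e ->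
    exists N, forall n, (N <= n)%N -> cabs ((p n).[z] * f z - W z) <= e.
Proof.
move=> fa Ww la lw pW z z1 e e0; pose r := (1 + cabs z) / 2.
have z0 := cabs_ge0 z.
have r0 : 0 < r by rewrite /r; lra.
have r1 : r < 1 by rewrite /r; lra.
have zr : cabs z <= r by rewrite /r; lra.
have [K K0 hK] := point_evaluation_bound omega_pos omega_lim r0 r1.
have eK : 0 < e / K by rewrite divr_gt0.
have [|N hN] := pW ((e / K) ^+ 2); first by rewrite exprn_gt0.
exists N => n Nn; have lc := l2_conv omega_pos omega_lim (p n) la.
have diff := power_seriesB (@power_series_conv _ (p n) _ _ fa) Ww.
have := hK _ _ (e / K) diff (l2B omega_pos lc lw) (ltW eK) (hN n Nn) z zr.
by rewrite mulrC divfK ?lt0r_neq0.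
Qed.

End Assembly.

(** * Extension of the quotient beyond the unit circle *)

Section ZeroFreeExtension.
Context {R : realType}.
Notation C := (cplx R).
Variable omega : nat -> R.
Hypothesis omega_pos : forall n, 0 < omega n.
Hypothesis omega0 : omega 0%N = 1.
Hypothesis omega_lim : omega n / omega n.+1 @[n --> \oo] --> (1 : R).
Variables (f W : C -> C) (a w : nat -> C) (p : nat -> {poly C}).
Hypothesis fa : power_series a f.
Hypothesis la : l2 omega a.
Hypothesis f0 : f 0 != 0.
Hypothesis Ww : power_series w W.
Hypothesis W0 : W 0 != 0.
Hypothesis p_opt : forall n, optimal_approximant omega f n (p n).
Hypothesis p_lim : forall z, cabs z < 1 -> forall e, 0 < e ->
  exists N, forall n, (N <= n)%N -> cabs ((p n).[z] * f z - W z) <= e.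

Let size_p n : (size (p n) <= n.+1)%N := (p_opt n).1.

Lemma optimal_coef_bound r : 0 < r < 1 ->
  exists K, forall n j, cabs (p n)`_j * r ^+ j <= K.
Proof.
move=> r01; have [K K0 hK] := coef_bound omega_pos omega_lim fa la f0 r01.
exists (K * 1) => n j; apply: hK => //.
by rewrite expr1n; apply: nsq_optimal_le1 (p_opt n).
Qed.

Lemma optimal_locally_bounded s : 0 < s -> s < 1 ->
  exists B, forall n z, cabs z <= s -> cabs (p n).[z] <= B.
Proof.
move=> s0 s1; pose r := (1 + s) / 2.
have r01 : 0 < r < 1 by apply/andP; split; rewrite /r; lra.
have sr : s < r by rewrite /r; lra.
have /andP[r0 r1] := r01.
have [K hK] := optimal_coef_bound r01.
have q0 : 0 <= s / r by rewrite divr_ge0// ltW.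
have q1 : s / r < 1 by rewrite ltr_pdivrMr// mul1r.
exists (K / (1 - s / r)) => n z zs.
have K0 : 0 <= K.
  by apply: le_trans (hK 0%N 0%N); rewrite mulr_ge0 ?cabs_ge0 ?exprn_ge0 ?(ltW r0).
rewrite horner_coef; apply: le_trans (cabs_sum _ _ _) _.
apply: (@le_trans _ _ (\sum_(i < size (p n)) K * (s / r) ^+ i)).
  apply: ler_sum => i _; rewrite cabsM cabsX.
  apply: (@le_trans _ _ (cabs (p n)`_i * s ^+ i)).
    by rewrite ler_wpM2l ?cabs_ge0// lerXn2r ?nnegrE ?cabs_ge0 ?(ltW s0).
  rewrite -[s in leLHS](divfK (lt0r_neq0 r0)) exprMn mulrCA mulrC.
  by rewrite ler_wpM2r ?exprn_ge0.
by rewrite -mulr_sumr ler_wpM2l// geometric_sum_le.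
Qed.

(** [n0] is chosen before [e]: it depends only on when [p_n f] gets close to [W] at [b]. *)
Lemma zero_free_near_bound zeta delta : cabs zeta = 1 -> 0 < delta ->
  (forall n z, cabs (z - zeta) < delta -> ~~ root (p n) z) ->
  exists n0, forall e, 0 < e -> exists2 K, 0 < K & forall n, (n0 <= n)%N ->
    forall z, cabs (z - zeta) <= delta / 8 -> cabs (p n).[z] <= K * (1 + e) ^+ n.
Proof.
move=> zeta1 delta0 zf.
(* Radii beyond [r0] bring [b = r zeta] within [delta / 8] of [zeta], as [zero_free_growth] demands;
   among them is one whose circle is free of zeros of [W]. *)
have [r0 [r0h r0d r01]] : exists r0, [/\ 1 / 2 <= r0, 1 - delta / 8 <= r0 & r0 < 1].
  exists (Num.max (1 / 2) (1 - delta / 8)).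
  by split; rewrite ?le_max ?gt_max ?lexx ?orbT//; apply/andP; split; lra.
have m1 : (1 + r0) / 2 < 1 by lra.
have m0 : r0 < (1 + r0) / 2 by lra.
have [r /andP[r0r rm] Wr] := zero_free_circle Ww W0 m0 m1.
have rpos : 0 < r by lra.
have r1 : r < 1 by lra.
pose b := ofreal r * zeta.
have cb : cabs b = r by rewrite cabsM zeta1 mulr1 cabs_ofreal gtr0_norm.
have b1 : cabs b < 1 by rewrite cb.
have bz : cabs (b - zeta) <= delta / 8.
  have -> : b - zeta = (ofreal r - 1) * zeta by rewrite /b mulrBl mul1r.
  rewrite -(rmorph1 (@ofreal R)) -rmorphB cabsM zeta1 mulr1 cabs_ofreal ltr0_norm; lra.
have Wb : 0 < cabs (W b) by rewrite cabs_gt0 Wr.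
have Wb2 : 0 < cabs (W b) / 2 by rewrite divr_gt0.
have [n0 hn0] := p_lim b1 Wb2.
pose F := 1 + cabs (f b).
have F0 : 0 < F by rewrite ltr_pwDl// cabs_ge0.
have lower n : (n0 <= n)%N -> cabs (W b) / 2 / F <= cabs (p n).[b].
  move=> /hn0; rewrite cabsB => h; have := cabs_rev (W b) ((p n).[b] * f b).
  rewrite cabsM ler_pdivrMr// => h'.
  apply: (@le_trans _ _ (cabs (p n).[b] * cabs (f b))); first by lra.
  by rewrite ler_wpM2l ?cabs_ge0// /F lerDr.
(* The disk of radius [(1 - r) / 2] about [b] lies in the disk of radius [(1 + r) / 2 < 1] about 0,
   where the [p_n] are uniformly bounded. *)
have y0 : 0 < (1 - r) / 2 by lra.
have s0 : 0 < (1 + r) / 2 by lra.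
have s1 : (1 + r) / 2 < 1 by lra.
have [B hB] := optimal_locally_bounded s0 s1.
exists n0 => e e0.
have c0 : 0 < cabs (W b) / 2 / F by rewrite divr_gt0.
have [K K0 hK] := @zero_free_growth _ zeta b delta ((1 - r) / 2) B _ e delta0 bz y0 c0 e0.
exists K => // n nn z zz; apply: (hK n (p n)) => //.
- exact: zf.
- exact: lower.
move=> v vb; apply: hB; rewrite -[v](subrK b).
by apply: le_trans (cabsD _ _) _; rewrite cb; lra.
Qed.

(** Norms in the space control coefficients only at radii below 1. But [p_(n+1) - p_n] has degree at
    most [n + 1], so passing from radius [R0 / t] to [R0] costs at most [t ^ n.+1], and the
    exponential decay pays for it. *)
Lemma decay_extension n0 q K : 0 < q < 1 -> 0 < K ->
  (forall n, (n0 <= n)%N -> cabs (p n)`_n <= K * q ^+ n) ->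
  exists r g, [/\ 1 < r, analytic_in_disk r g &
    forall z, disk 1 z -> f z != 0 -> g z = W z / f z].
Proof.
move=> /andP[q0 q1] K0 hp.
have [q2 [q20 q21 qq2]] : exists q2, [/\ 0 < q2, q2 < 1 & q < q2].
  by exists ((1 + q) / 2); split; lra.
have qq : 0 < q ^+ 2 by rewrite exprn_gt0.
have [e e0 he] : exists2 e, 0 < e & q ^+ 2 * (1 + e) = q2 ^+ 2.
  exists (q2 ^+ 2 / q ^+ 2 - 1); last by field; rewrite lt0r_neq0.
  by rewrite subr_gt0 ltr_pdivlMr// mul1r ltrXn2r// ?ltW.
(* [t > 1] is the enlargement of the radius that the decay rate [q2] can afford; then [R0] is taken
   between 1 and [t]. *)
have [t t1 tq] : exists2 t, 1 < t & q2 * t < 1.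
  have iq : 1 < q2^-1 by rewrite invf_gt1.
  exists ((1 + q2^-1) / 2); first lra.
  have -> : q2 * ((1 + q2^-1) / 2) = (1 + q2) / 2 by field; rewrite lt0r_neq0.
  lra.
have [R0 R01 R0t] : exists2 R0, 1 < R0 & R0 < t by exists ((1 + t) / 2); lra.
have t0 : 0 < t by lra.
have R00 : 0 < R0 by lra.
have r01 : 0 < R0 / t < 1 by rewrite divr_gt0//= ltr_pdivrMr// mul1r.
have [K3 K30 hK3] := coef_bound omega_pos omega_lim fa la f0 r01.
have [K2 K20 hK2] := nsq_shiftn omega_pos omega_lim e0 la.
(* Chosen so that [K ^ 2 K2 <= M ^ 2], which avoids a square root of [K2]. *)
pose M := K * (1 + K2).
have M0 : 0 < M by rewrite mulr_gt0// addr_gt0.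
have Q0 : 0 < q2 * t by rewrite mulr_gt0.
have diff n j : (n0 <= n)%N ->
    cabs ((p n.+1)`_j - (p n)`_j) * R0 ^+ j <= K3 * M * (q2 * t) ^+ n.+1.
  move=> nn; rewrite -coefB.
  have [nj|jn] := ltnP n.+1 j.
    have sj : (size (p n.+1 - p n)%R <= j)%N.
      rewrite (leq_trans (size_polyD _ _))// geq_max size_polyN.
      by rewrite (leq_trans (size_p _))// (leq_trans (size_p n))// ltnW.
    rewrite nth_default// cabs0 mul0r.
    exact: mulr_ge0 (ltW (mulr_gt0 K30 M0)) (exprn_ge0 _ (ltW Q0)).
  have nsq_le : nsq omega (conv (p n.+1 - p n) a) <= (M * q2 ^+ n.+1) ^+ 2.
    apply: le_trans (nsq_optimal_diff_le omega_pos omega_lim fa la (p_opt n) (p_opt n.+1)) _.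
    apply: (@le_trans _ _ ((K * q ^+ n.+1) ^+ 2 * (K2 * (1 + e) ^+ n.+1))).
      apply: ler_pM; rewrite ?sqr_ge0//.
      - by apply: nsq_ge0 => //; exact: l2_shiftn.
      - have hl := hp n.+1 (leqW nn).
        by rewrite lerXn2r ?nnegrE ?cabs_ge0// (le_trans _ hl)// cabs_ge0.
    rewrite [(M * _) ^+ 2]exprMn [(q2 ^+ n.+1) ^+ 2]exprAC -he.
    rewrite [(q ^+ 2 * (1 + e)) ^+ n.+1]exprMn [(K * _) ^+ 2]exprMn.
    rewrite [(q ^+ n.+1) ^+ 2]exprAC.
    move: ((q ^+ 2) ^+ n.+1) ((1 + e) ^+ n.+1) (exprn_ge0 n.+1 (ltW qq))
      (exprn_ge0 n.+1 (ltW (addr_gt0 ltr01 e0))) => X Y X0 Y0.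
    have -> : K ^+ 2 * X * (K2 * Y) = K2 * (K ^+ 2 * (X * Y)) by ring.
    have -> : M ^+ 2 * (X * Y) = (1 + K2) ^+ 2 * (K ^+ 2 * (X * Y)) by rewrite /M; ring.
    apply: ler_wpM2r; first by rewrite mulr_ge0 ?sqr_ge0// mulr_ge0.
    by have := sqr_ge0 K2; lra.
  have M1 : 0 <= M * q2 ^+ n.+1 by exact: mulr_ge0 (ltW M0) (exprn_ge0 _ (ltW q20)).
  have := hK3 _ _ M1 nsq_le j.
  have -> : R0 ^+ j = (R0 / t) ^+ j * t ^+ j by rewrite -exprMn divfK ?lt0r_neq0.
  move=> H; rewrite mulrA; apply: le_trans (ler_wpM2r (exprn_ge0 j (ltW t0)) H) _.
  have -> : K3 * M * (q2 * t) ^+ n.+1 = K3 * (M * q2 ^+ n.+1) * t ^+ n.+1.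
    by rewrite [(q2 * t) ^+ _]exprMn; ring.
  apply: ler_wpM2l; first exact: mulr_ge0 (ltW K30) M1.
  by rewrite ler_weXn2l// (ltW t1).
have [||r [g [r1 ga glim]]] := @polynomial_limit_analytic _ (fun m => p (n0 + m)%N)
    (K3 * M * (q2 * t) ^+ n0.+1) (q2 * t) R0 _ (ltW Q0) tq R01.
- exact: mulr_ge0 (ltW (mulr_gt0 K30 M0)) (exprn_ge0 _ (ltW Q0)).
- move=> n j; rewrite addnS; apply: le_trans (diff _ _ (leq_addr _ _)) _.
  by rewrite -!mulrA -exprD addSn.
exists r, g; split => // z z1 fz.
apply: (mulIf fz); rewrite divfK//; apply/eqP.
rewrite -subr_eq0 -cabs_eq0 eq_le cabs_ge0 andbT.
apply/ler_addgt0Pr => d d0; rewrite add0r.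
have d2 : 0 < d / 2 by rewrite divr_gt0.
have F0 : 0 < 1 + cabs (f z) by rewrite ltr_pwDl// cabs_ge0.
have d3 : 0 < d / 2 / (1 + cabs (f z)) by rewrite divr_gt0.
have [N1 h1] := p_lim z1 d2.
have [N2 h2] := glim z (lt_trans z1 r1) _ d3.
have H1 := h1 (n0 + maxn N1 N2)%N (leq_trans (leq_maxl _ _) (leq_addl _ _)).
have H2 := h2 (maxn N1 N2) (leq_maxr _ _).
apply: le_trans (cabs_subr _ ((p (n0 + maxn N1 N2)%N).[z] * f z) _) _.
rewrite [d]splitr lerD// -mulrBl cabsM.
apply: le_trans (ler_wpM2r (cabs_ge0 _) H2) _.
by rewrite mulrAC ler_pdivrMr// ler_wpM2l ?(ltW d2)// lerDr.
Qed.

Lemma zero_free_extension zeta delta : cabs zeta = 1 -> 0 < delta ->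
  (forall n z, cabs (z - zeta) < delta -> ~~ root (p n) z) ->
  exists r g, [/\ 1 < r, analytic_in_disk r g &
    forall z, disk 1 z -> f z != 0 -> g z = W z / f z].
Proof.
move=> zeta1 delta0 zf; have [n0 near_bound] := zero_free_near_bound zeta1 delta0 zf.
have d8 : 0 < delta / 8 by rewrite divr_gt0.
have [q q01 [K K0 hK]] := leading_coef_decay zeta1 d8 size_p near_bound optimal_coef_bound.
exact: decay_extension q01 K0 hK.
Qed.

End ZeroFreeExtension.

Theorem theorem6p2 (R : realType) (omega : nat -> R)
    (omega_pos : forall n, 0 < omega n)
    (omega0 : omega 0%N = 1)
    (omega_qi : quasi_integral omega)
    (omega_lim : omega n / omega n.+1 @[n --> \oo] --> (1 : R))
    (f : cplx R -> cplx R) (f_H2 : H2 omega f)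
    (W : cplx R -> cplx R) (W_proj : is_W omega f W)
    (W_sing : quotient_singular_on_circle W f)
    (f0 : f 0 != 0)
    (p : nat -> {poly cplx R})
    (p_opt : forall n, optimal_approximant omega f n (p n)) :
  forall zeta : cplx R, circle zeta ->
    limit_point [set z : cplx R | exists n, root (p n) z] zeta.
Proof.
move=> zeta zeta1 U /nbhs_ballP[d /posC[delta delta0 ->] ballU].
apply: contrapT => none.
have fa : power_series (coefs f) f by have [[a fa] _] := f_H2; rewrite (coefsE fa).
have la := h2sqnorm_l2 omega_pos fa f_H2.2.
have W_H2 := W_proj.1.1.
have Ww : power_series (coefs W) W by have [[w Ww] _] := W_H2; rewrite (coefsE Ww).
have lw := h2sqnorm_l2 omega_pos Ww W_H2.2.
have W0 := proj_at0_neq0 omega_pos omega0 omega_lim fa la Ww lw W_proj f0.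
have p_lim := quotient_limit omega_pos omega_lim fa Ww la lw
  (optimal_cvg_proj omega_pos omega_lim fa la Ww lw W_proj p_opt).
have delta2 : 0 < delta / 2 by rewrite divr_gt0.
(* The radius used at [zeta'] is exactly its distance to [zeta]: the open disk omits [zeta] and lies
   in the given neighbourhood. *)
have [zeta' zeta'1 /andP[d0 dd]] := nearby_circle_point zeta1 delta2.
apply: W_sing.
apply: (zero_free_extension omega_pos omega0 omega_lim fa la f0 Ww W0 p_opt p_lim zeta'1 d0).
move=> n z zz; apply/negP => rz; apply: none; exists z; split; last 1 first.
- apply: ballU; rewrite /ball /= normE ofreal_lt cabsB.
  by apply: le_lt_trans (cabs_subr _ zeta' _) _; lra.
- apply/negP => /eqP zE; move: zz; rewrite zE cabsB.
  by rewrite ltxx.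
- by exists n.
Qed.
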